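(* Let $m,n\ge 1$ be integers. For any $\ell$-ideals $I$ of $\mathcal M([0,1]^m)$ and $J$ of $\mathcal M([0,1]^n)$ the following conditions are equivalent: (i) $\mathcal M([0,1]^m)/I\cong \mathcal M([0,1]^n)/J$ (as unital $\ell$-groups). (ii) For some $P\in\mathcal Z(I)$, some $Q\in\mathcal Z(J)$ and some $\mathbb Z$-homeomorphism $\eta$ of $P$ onto $Q$, the map $X\mapsto \eta(X)$ sends $\mathcal Z(I)_{\cap P}$ one-one onto $\mathcal Z(J)_{\cap Q}$.
   Context: A unital $\ell$-group $(G,u)$ is an abelian group $G$ with a lattice structure such that $x+(y\vee z)=(x+y)\vee(x+z)$ for all $x,y,z$, together with a distinguished order-unit $u$, i.e. for every $g\in G$ there is an integer $k\ge 0$ with $g\le ku$. Unital $\ell$-homomorphisms are group homomorphisms preserving $\vee,\wedge$ and the order-unit; $\cong$ means there is a bijective one. An $\ell$-ideal of $(G,u)$ is the kernel of a unital $\ell$-homomorphism, and $(G,u)/I$ is the quotient unital $\ell$-group. $\mathcal M([0,1]^n)$ is the unital $\ell$-group (pointwise operations, order-unit the constant function $1$) of all continuous functions $f\colon[0,1]^n\to\mathbb R$ that are piecewise linear with finitely many pieces, each piece having integer coefficients (''linear'' is meant in the affine sense, so that each piece is an affine function with integer coefficients). For an $\ell$-ideal $I$ of $\mathcal M([0,1]^n)$, $\mathcal Z(I)=\{X\subseteq[0,1]^n\mid \exists g\in I,\ X=g^{-1}(0)\}$, and for $P\in\mathcal Z(I)$, $\mathcal Z(I)_{\cap P}=\{X\cap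 P\mid X\in\mathcal Z(I)\}$. A rational polyhedron in $\mathbb R^n$ is a finite union of convex hulls of finite sets of rational points of $\mathbb R^n$ (zerosets of functions in $\mathcal M([0,1]^n)$ are rational polyhedra). For rational polyhedra $P\subseteq\mathbb R^m$ and $Q\subseteq\mathbb R^n$, a $\mathbb Z$-homeomorphism of $P$ onto $Q$ is a piecewise linear homeomorphism $\eta$ of $P$ onto $Q$ (finitely many affine pieces) such that all linear pieces of both $\eta$ and $\eta^{-1}$ have integer coefficients. *)

(* Defs.v *)
From HB Require Import structures.
From mathcomp Require Import all_boot all_order all_algebra generic_quotient.
From mathcomp Require Import ring_quotient.
From mathcomp Require Import all_classical all_reals all_analysis.

Set Implicit Arguments.
Unset Strict Implicit.
Unset Printing Implicit Defensive.

Import Order.TTheory GRing.Theory Num.Theory numFieldNormedType.Exports.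

Local Open Scope classical_set_scope.
Local Open Scope ring_scope.

(* The lattice structure is given by its two operations; the order is recovered
   from x <= y iff x /\ y = x, which is how the order-unit property is stated. *)
HB.mixin Record isUnitalLGroup G of GRing.Zmodule G := {
  ljoin : G -> G -> G;
  lmeet : G -> G -> G;
  ljoinC : commutative ljoin;
  lmeetC : commutative lmeet;
  ljoinA : associative ljoin;
  lmeetA : associative lmeet;
  ljoinKI : forall x y, lmeet x (ljoin x y) = x;
  lmeetKU : forall x y, ljoin x (lmeet x y) = x;
  addr_ljoinr : forall x y z, x + ljoin y z = ljoin (x + y) (x + z);
  order_unit : G;
  order_unitP : forall g, exists k : nat,
    lmeet g (order_unit *+ k) = g
}.

#[short(type="ulgroupType")]
HB.structure Definition UnitalLGroup :=
  {G of isUnitalLGroup G & GRing.Zmodule G}.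

Arguments order_unit {s}.

Definition ul_hom (G H : ulgroupType) (f : G -> H) : Prop :=
  [/\ {morph f : x y / x + y},
      {morph f : x y / ljoin x y},
      {morph f : x y / lmeet x y}
    & f order_unit = order_unit].

Definition ul_isomorphic (G H : ulgroupType) : Prop :=
  exists2 f : G -> H, ul_hom f & bijective f.

Definition is_lideal (G : ulgroupType) (I : set G) : Prop :=
  exists (H : ulgroupType) (f : G -> H), ul_hom f /\ I = f @^-1` [set 0].

Record lideal (G : ulgroupType) := LIdeal {
  lideal_set :> set G;
  lideal_proof : is_lideal lideal_set
}.

Section LQuotient.
Variables (G : ulgroupType) (I : lideal G).
Local Open Scope quotient_scope.

Definition lideal_pred : G -> bool := fun x => `[< lideal_set I x >].

Lemma ul_homB (H : ulgroupType) (f : G -> H) :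
  ul_hom f -> {morph f : x y / x - y}.
Proof.
case=> fD _ _ _ x y; apply: (addIr (f y)).
by rewrite subrK -fD subrK.
Qed.

Lemma lideal_kerE : exists (H : ulgroupType) (f : G -> H),
  ul_hom f /\ forall x, lideal_pred x = (f x == 0).
Proof.
case: (lideal_proof I) => H [f [hf EI]]; exists H, f; split=> // x.
by rewrite /lideal_pred EI; apply/asboolP/eqP.
Qed.

Lemma lideal_zmod_closed : zmod_closed lideal_pred.
Proof.
have [H [f [hf E]]] := lideal_kerE; have fB := ul_homB hf.
split=> [|x y]; rewrite -!topredE /= !E.
  by have := fB 0 0; rewrite !subrr => ->.
by rewrite fB => /eqP-> /eqP->; rewrite subrr.
Qed.

HB.instance Definition _ := GRing.isZmodClosed.Build G lideal_pred
  lideal_zmod_closed.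

Definition lideal_zmod := GRing.ZmodClosed.clone G lideal_pred _.

Definition lquot : Type := Quotient.quot lideal_zmod.

HB.instance Definition _ := Choice.on lquot.
HB.instance Definition _ := GRing.Zmodule.on lquot.
HB.instance Definition _ := Quotient.on lquot.

Lemma lquot_kerE : exists (H : ulgroupType) (f : G -> H),
  ul_hom f /\ forall x y, (\pi_lquot x == \pi_lquot y) = (f x == f y).
Proof.
have [H [f [hf E]]] := lideal_kerE; exists H, f; split=> // x y.
rewrite -[LHS](Quotient.idealrBE lideal_zmod) -topredE /= E.
by rewrite (ul_homB hf) subr_eq0.
Qed.

Definition lquot_join := lift_op2 lquot (@ljoin G).
Definition lquot_meet := lift_op2 lquot (@lmeet G).

Lemma lquot_pi_join x y :
  \pi_lquot (ljoin x y) = lquot_join (\pi_lquot x) (\pi_lquot y).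
Proof.
have [H [f [[fD fU fI f1] E]]] := lquot_kerE.
unlock lquot_join; apply/eqP; rewrite E !fU.
have Er z : f z = f (repr (\pi_lquot z)) by apply/eqP; rewrite -E reprK.
by rewrite -!Er.
Qed.

Lemma lquot_pi_meet x y :
  \pi_lquot (lmeet x y) = lquot_meet (\pi_lquot x) (\pi_lquot y).
Proof.
have [H [f [[fD fU fI f1] E]]] := lquot_kerE.
unlock lquot_meet; apply/eqP; rewrite E !fI.
have Er z : f z = f (repr (\pi_lquot z)) by apply/eqP; rewrite -E reprK.
by rewrite -!Er.
Qed.

Lemma lquot_joinC : commutative lquot_join.
Proof. by move=> x y; rewrite -[x]reprK -[y]reprK -!lquot_pi_join ljoinC. Qed.
Lemma lquot_meetC : commutative lquot_meet.
Proof. by move=> x y; rewrite -[x]reprK -[y]reprK -!lquot_pi_meet lmeetC. Qed.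
Lemma lquot_joinA : associative lquot_join.
Proof.
by move=> x y z; rewrite -[x]reprK -[y]reprK -[z]reprK -!lquot_pi_join ljoinA.
Qed.
Lemma lquot_meetA : associative lquot_meet.
Proof.
by move=> x y z; rewrite -[x]reprK -[y]reprK -[z]reprK -!lquot_pi_meet lmeetA.
Qed.
Lemma lquot_joinKI x y : lquot_meet x (lquot_join x y) = x.
Proof.
by rewrite -[x]reprK -[y]reprK -lquot_pi_join -lquot_pi_meet ljoinKI.
Qed.
Lemma lquot_meetKU x y : lquot_join x (lquot_meet x y) = x.
Proof.
by rewrite -[x]reprK -[y]reprK -lquot_pi_meet -lquot_pi_join lmeetKU.
Qed.

Lemma lquot_piD x y : \pi_lquot (x + y) = \pi_lquot x + \pi_lquot y.
Proof. exact: (Quotient.pi_add lideal_zmod). Qed.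

Lemma lquot_addr_joinr x y z :
  x + lquot_join y z = lquot_join (x + y) (x + z).
Proof.
rewrite -[x]reprK -[y]reprK -[z]reprK.
move: (repr x) (repr y) (repr z) => {}x {}y {}z.
transitivity (\pi_lquot (x + ljoin y z)).
  by rewrite lquot_piD lquot_pi_join.
by rewrite addr_ljoinr lquot_pi_join !lquot_piD.
Qed.

Lemma lquot_order_unitP (g : lquot) :
  exists k : nat, lquot_meet g (\pi_lquot order_unit *+ k) = g.
Proof.
rewrite -[g]reprK; move: (repr g) => {}g.
have [k hk] := order_unitP g; exists k.
have -> : \pi_lquot order_unit *+ k = \pi_lquot (order_unit *+ k).
  elim: k {hk} => [|k IH]; last by rewrite !mulrS IH lquot_piD.
  by apply: (addIr (\pi_lquot 0)); rewrite -lquot_piD !add0r.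
by rewrite -lquot_pi_meet hk.
Qed.

HB.instance Definition _ := isUnitalLGroup.Build lquot
  lquot_joinC lquot_meetC lquot_joinA lquot_meetA lquot_joinKI lquot_meetKU
  lquot_addr_joinr lquot_order_unitP.

End LQuotient.

Section McNaughton.
Variable R : realType.

Definition cube n : set 'rV[R]_n := [set x | forall i, 0 <= x 0 i <= 1].

Arguments cube : clear implicits.

(* [zaffine (A, b)] is the affine map x |-> x A + b with integer coefficients;
   points of R^n are row vectors. *)
Definition zaffine m n (p : 'M[int]_(m, n) * 'rV[int]_n) (x : 'rV[R]_m) :
  'rV[R]_n := x *m map_mx intr p.1 + map_mx intr p.2.

(* A continuous function on a polyhedron is piecewise linear with finitely many
   integral pieces when, at every point, it agrees with one of finitely many
   integral affine functions; the pieces are then the closed sets on which it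
   agrees with each of them. *)
Definition is_mcnaughton n (f : cube n -> R) : Prop :=
  continuous f /\
  exists s : seq ('M[int]_(n, 1) * 'rV[int]_1),
    forall x, exists2 p, p \in s & f x = zaffine p (set_val x) 0 0.

Definition mcnaughton_pred n : pred (cube n -> R) :=
  fun f => `[< is_mcnaughton f >].

Record mcnaughton n := McNaughton {
  mcn_val :> cube n -> R;
  mcn_valP : mcnaughton_pred mcn_val
}.

HB.instance Definition _ n := [isSub for @mcn_val n].
HB.instance Definition _ n := [Choice of mcnaughton n by <:].

Lemma zaffineB m n (p q : 'M[int]_(m, n) * 'rV[int]_n) x :
  zaffine (p.1 - q.1, p.2 - q.2) x = zaffine p x - zaffine q x.
Proof. by rewrite /zaffine /= !map_mxB mulmxBr opprD addrACA. Qed.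

Lemma zaffine_cst m (b : int) (x : 'rV[R]_m) :
  zaffine (0 : 'M[int]_(m, 1), const_mx b) x 0 0 = b%:~R.
Proof. by rewrite /zaffine map_mx0 mulmx0 add0r !mxE. Qed.

Lemma mcn_cst n (b : int) : mcnaughton_pred (fun _ : cube n => b%:~R).
Proof.
apply/asboolP; split; first exact: cst_continuous.
exists [:: (0, const_mx b)] => x; eexists; first exact: mem_head.
by rewrite zaffine_cst.
Qed.

Lemma mcn_zmod_closed n : zmod_closed (@mcnaughton_pred n).
Proof.
split=> [|f g /asboolP[cf [s hs]] /asboolP[cg [t ht]]].
  exact: (mcn_cst n 0).
apply/asboolP; split.
  by move=> x; apply: (@continuousB R R^o); [exact: cf | exact: cg].
exists [seq (p.1 - q.1, p.2 - q.2) | p <- s, q <- t] => x.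
have [p ps fx] := hs x; have [q qt gx] := ht x.
exists (p.1 - q.1, p.2 - q.2).
  exact: (allpairs_f (fun p q => (p.1 - q.1, p.2 - q.2))).
by rewrite zaffineB [RHS]mxE [X in _ = _ + X]mxE -fx -gx.
Qed.

HB.instance Definition _ n := GRing.isZmodClosed.Build _
  (@mcnaughton_pred n) (@mcn_zmod_closed n).
HB.instance Definition _ n :=
  [SubChoice_isSubZmodule of mcnaughton n by <:].

Lemma mcn_min_closed n (f g : cube n -> R) :
  mcnaughton_pred f -> mcnaughton_pred g -> mcnaughton_pred (f \min g).
Proof.
move=> /asboolP[cf [s hs]] /asboolP[cg [t ht]].
apply/asboolP; split.
  by move=> x; apply: (@continuous_min R); [exact: cf | exact: cg].
exists (s ++ t) => x; have [p ps fx] := hs x; have [q qt gx] := ht x.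
rewrite /Order.min_fun; have [_|_] := leP (f x) (g x).
  by exists p; rewrite // mem_cat ps.
by exists q; rewrite // mem_cat qt orbT.
Qed.

Lemma mcn_max_closed n (f g : cube n -> R) :
  mcnaughton_pred f -> mcnaughton_pred g -> mcnaughton_pred (f \max g).
Proof.
move=> /asboolP[cf [s hs]] /asboolP[cg [t ht]].
apply/asboolP; split.
  by move=> x; apply: (@continuous_max R); [exact: cf | exact: cg].
exists (s ++ t) => x; have [p ps fx] := hs x; have [q qt gx] := ht x.
rewrite /Order.max_fun; have [_|_] := leP (f x) (g x).
  by exists q; rewrite // mem_cat qt orbT.
by exists p; rewrite // mem_cat ps.
Qed.

Definition mcn_min n (f g : mcnaughton n) : mcnaughton n :=
  McNaughton (mcn_min_closed (mcn_valP f) (mcn_valP g)).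
Definition mcn_max n (f g : mcnaughton n) : mcnaughton n :=
  McNaughton (mcn_max_closed (mcn_valP f) (mcn_valP g)).

Lemma mcn_eqP n (f g : mcnaughton n) : f =1 g -> f = g.
Proof. by move=> fg; apply: val_inj; apply/funext. Qed.

Lemma mcn_maxC n : commutative (@mcn_max n).
Proof. by move=> f g; apply: mcn_eqP => x /=; rewrite maxC. Qed.
Lemma mcn_minC n : commutative (@mcn_min n).
Proof. by move=> f g; apply: mcn_eqP => x /=; rewrite minC. Qed.
Lemma mcn_maxA n : associative (@mcn_max n).
Proof. by move=> f g h; apply: mcn_eqP => x /=; rewrite maxA. Qed.
Lemma mcn_minA n : associative (@mcn_min n).
Proof. by move=> f g h; apply: mcn_eqP => x /=; rewrite minA. Qed.
Lemma mcn_maxKI n (f g : mcnaughton n) : mcn_min f (mcn_max f g) = f.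
Proof. by apply: mcn_eqP => x /=; apply/min_idPl; rewrite le_max lexx. Qed.
Lemma mcn_minKU n (f g : mcnaughton n) : mcn_max f (mcn_min f g) = f.
Proof. by apply: mcn_eqP => x /=; apply/max_idPl; rewrite ge_min lexx. Qed.

Lemma mcn_addr_maxr n (f g h : mcnaughton n) :
  f + mcn_max g h = mcn_max (f + g) (f + h).
Proof.
apply: mcn_eqP => x.
change (f x + Num.max (g x) (h x) = Num.max (f x + g x) (f x + h x)).
by rewrite addr_maxr.
Qed.

Definition mcn_one n : mcnaughton n := McNaughton (mcn_cst n 1).

Lemma mcn_natE n k (x : cube n) : (mcn_one n *+ k) x = k%:R.
Proof.
elim: k => [//|k IH]; rewrite !mulrS.
by change (1%:~R + (mcn_one n *+ k) x = 1 + k%:R); rewrite IH.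
Qed.

Lemma zaffine_bound n (p : 'M[int]_(n, 1) * 'rV[int]_1) :
  exists k : nat, forall x : 'rV[R]_n, cube n x -> zaffine p x 0 0 <= k%:R.
Proof.
exists (\sum_i absz (p.1 i 0%R) + absz (p.2 0%R 0%R))%N => x xc.
rewrite /zaffine !mxE natrD natr_sum; apply: lerD.
  apply: ler_sum => i _; rewrite !mxE.
  have /andP[x0 x1] := xc i.
  apply: (@le_trans _ _ (x 0 i * `|p.1 i 0|%:~R)).
    by apply: ler_wpM2l => //; rewrite ler_int ler_norm.
  rewrite natr_absz.
  by apply: ler_piMl => //; rewrite ler0z.
by rewrite natr_absz ler_int ler_norm.
Qed.

Lemma mcn_order_unitP n (f : mcnaughton n) :
  exists k : nat, mcn_min f (mcn_one n *+ k) = f.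
Proof.
have /asboolP[_ [s hs]] := mcn_valP f.
have [k hk] : exists k : nat, forall p, p \in s ->
    forall x : 'rV[R]_n, cube n x -> zaffine p x 0 0 <= k%:R.
  elim: s {hs} => [|p s [k IH]]; first by exists 0%N.
  have [l hl] := zaffine_bound p; exists (k + l)%N => q.
  rewrite inE => /orP[/eqP->|qs] x xc.
    by apply: (le_trans (hl x xc)); rewrite ler_nat leq_addl.
  by apply: (le_trans (IH q qs x xc)); rewrite ler_nat leq_addr.
exists k; apply: mcn_eqP => x /=; rewrite mcn_natE; apply/min_idPl.
by have [p ps ->] := hs x; apply: hk => //; exact: set_valP.
Qed.

HB.instance Definition _ n := isUnitalLGroup.Build (mcnaughton n)
  (@mcn_maxC n) (@mcn_minC n) (@mcn_maxA n) (@mcn_minA n) (@mcn_maxKI n)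
  (@mcn_minKU n) (@mcn_addr_maxr n) (@mcn_order_unitP n).

Definition zeroset n (f : mcnaughton n) : set 'rV[R]_n :=
  set_val @` (f @^-1` [set 0]).

Definition zerosets n (I : lideal (mcnaughton n)) : set (set 'rV[R]_n) :=
  @zeroset n @` I.

Definition zerosets_cap n (I : lideal (mcnaughton n)) (P : set 'rV[R]_n) :
  set (set 'rV[R]_n) := [set X `&` P | X in zerosets I].

(* Maps between P and Q are represented by total functions, of which only the
   restriction to P matters. *)
Definition is_zmap m n (P : set 'rV[R]_m) (f : 'rV[R]_m -> 'rV[R]_n) : Prop :=
  {within P, continuous f} /\
  exists s : seq ('M[int]_(m, n) * 'rV[int]_n),
    forall x, P x -> exists2 p, p \in s & f x = zaffine p x.

(* Meant for rational polyhedra P and Q, such as the zerosets of McNaughton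
   functions, which are the only sets it is applied to; [theta] is the inverse
   of [eta], so that the homeomorphism is integral in both directions. *)
Definition is_zhomeo m n (P : set 'rV[R]_m) (Q : set 'rV[R]_n)
    (eta : 'rV[R]_m -> 'rV[R]_n) : Prop :=
  [/\ set_bij P Q eta,
      is_zmap P eta
    & exists2 theta : 'rV[R]_n -> 'rV[R]_m,
        {in P, cancel eta theta} & is_zmap Q theta].

End McNaughton.

Arguments cube R n : clear implicits.

(* Main.v *)
(* (i) => (ii): lift the images of the coordinate functions under the isomorphism and
   its inverse to McNaughton functions [b] and [c].  A McNaughton function lies in the
   unital l-group generated by the coordinates, so the isomorphism is composition with
   [b] and its inverse composition with [c]; the fixed points of [b o c] and of [c o b]
   form P and Q, and [c] restricts to eta.
   (ii) => (i): extend eta and its inverse to McNaughton maps of the cubes and compose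
   with these extensions.  An l-ideal is determined by its zerosets, because
   Z(f) <= Z(g) implies |g| <= k |f| for some k.
   Everything rests on one fact: a continuous function on a convex set that agrees
   pointwise with finitely many affine functions satisfies, for all a and b,
   h(a) <= r(a) and r(b) <= h(b) for one of these functions r.  It replaces
   triangulations: h is affine on each cell where the order of its pieces is fixed,
   Farkas' lemma on the cells gives |g| <= k |f|, and finite max-min combinations give
   both the generation by coordinates and the extension of integral piecewise affine
   functions from a zeroset to the cube. *)

Require Import Defs.
From mathcomp Require Import all_boot all_order all_algebra.
From mathcomp Require Import generic_quotient ring_quotient.
From mathcomp Require Import all_classical all_reals all_analysis.
From mathcomp Require Import lra.

Set Implicit Arguments.
Unset Strict Implicit.
Unset Printing Implicit Defensive.

Import Order.TTheory GRing.Theory Num.Theory numFieldNormedType.Exports.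

Local Open Scope classical_set_scope.
Local Open Scope ring_scope.

(** * Two-point property of piecewise affine functions on the unit interval *)

(** Both points range over [0,1] only, so values of [g] outside the interval are irrelevant. *)
Definition cont01 (R : realType) (g : R -> R) : Prop :=
  forall t, 0 <= t <= 1 -> forall e, 0 < e -> exists2 d, 0 < d &
    forall u, 0 <= u <= 1 -> `|t - u| < d -> `|g t - g u| < e.

Lemma cont01B (R : realType) (g h : R -> R) :
  cont01 g -> cont01 h -> cont01 (fun t => g t - h t).
Proof.
move=> cg ch t t01 e e0; have e20 : 0 < e / 2 by lra.
have [d d0 hd] := cg t t01 _ e20; have [d' d'0 hd'] := ch t t01 _ e20.
exists (Num.min d d') => [|u u01]; first by rewrite lt_min d0.
rewrite lt_min => /andP[/hd - /(_ u01) ? /hd' - /(_ u01) ?].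
have -> : g t - h t - (g u - h u) = (g t - g u) - (h t - h u) by lra.
by apply: le_lt_trans (ler_normB _ _) _; lra.
Qed.

Lemma cont01_affine (R : realType) (a b : R) : cont01 (fun t => a + t * b).
Proof.
move=> t _ e e0; have k0 : 0 < 1 + `|b| by have := normr_ge0 b; lra.
exists (e / (1 + `|b|)) => [|u _]; first exact: divr_gt0.
rewrite ltr_pdivlMr // => tu.
have -> : a + t * b - (a + u * b) = (t - u) * b by lra.
rewrite normrM; apply: le_lt_trans tu; apply: ler_wpM2l => //; lra.
Qed.

(** The positive product says that the sign of [g] persists near [t], for both signs at once. *)
Lemma cont01_neq0 (R : realType) (g : R -> R) t :
  cont01 g -> 0 <= t <= 1 -> g t != 0 -> exists2 d, 0 < d &
    forall u, 0 <= u <= 1 -> `|t - u| < d -> 0 < g t * g u.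
Proof.
move=> cg t01 gt; have [|d d0 hd] := cg t t01 `|g t|; first by rewrite normr_gt0.
exists d => // u u01 /(hd u u01) {hd}.
have [g0|g0|g0] := ltrgtP (g t) 0; last by rewrite g0 eqxx in gt.
  by rewrite (ltr0_norm g0) ltr_norml => /andP[? ?]; rewrite nmulr_rgt0 //; lra.
by rewrite (gtr0_norm g0) ltr_norml => /andP[? ?]; rewrite pmulr_rgt0 //; lra.
Qed.

(** A piece that differs from [g] at [t] differs from it on a neighbourhood, by continuity; with
    finitely many pieces, only those active at [t] are used near [t]. *)
Lemma local_pieces (R : realType) (g : R -> R) (q : seq (R * R)) t :
  cont01 g -> 0 <= t <= 1 -> exists2 d, 0 < d & forall u, 0 <= u <= 1 ->
    `|t - u| < d -> forall c, c \in q -> g u = c.1 + u * c.2 ->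
    g t = c.1 + t * c.2.
Proof.
move=> cg t01; elim: q => [|c q [d d0 hd]]; first by exists 1.
have [gt|gt] := eqVneq (g t) (c.1 + t * c.2).
  by exists d => // u u01 tu c'; rewrite inE => /orP[/eqP-> //|]; exact: hd.
have cgc := cont01B cg (cont01_affine c.1 c.2).
have [|d1 d10 hd1] := cont01_neq0 cgc t01; first by rewrite subr_eq0.
exists (Num.min d d1) => [|u u01]; first by rewrite lt_min d0.
rewrite lt_min => /andP[tu tu1] c'; rewrite inE => /orP[/eqP-> gu|]; last exact: hd.
by have := hd1 u u01 tu1; rewrite gu subrr mulr0 ltxx.
Qed.

(** A piece that vanishes in [0,1] with slope at most 0 is a witness. Without one, [g] crosses every
    zero upwards, which is impossible for a continuous function vanishing at both ends: the supremum
    of the initial stretch where [g] is positive gives a contradiction. *)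
Lemma segment_two_point0 (R : realType) (g : R -> R) (q : seq (R * R)) :
  cont01 g -> g 0 = 0 -> g 1 = 0 ->
  (forall t, 0 <= t <= 1 -> exists2 c, c \in q & g t = c.1 + t * c.2) ->
  exists2 c, c \in q & 0 <= c.1 /\ c.1 + c.2 <= 0.
Proof.
move=> cg g0 g1 hq; apply: contrapT => noc.
have slope t c : 0 <= t <= 1 -> c \in q -> c.1 + t * c.2 = 0 -> 0 < c.2.
  move=> /andP[t0 t1] cq gt; rewrite ltNge; apply/negP => le.
  by apply: noc; exists c => //; split; clear -t0 t1 gt le; nra.
have sgz t : 0 <= t <= 1 -> g t = 0 -> exists2 d, 0 < d &
    forall u, 0 <= u <= 1 -> `|t - u| < d ->
      (u < t -> g u < 0) /\ (t < u -> 0 < g u).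
  move=> t01 gt; have [d d0 hd] := local_pieces q cg t01; exists d => // u u01 tu.
  have [c cq gu] := hq u u01; have gt' := hd u u01 tu c cq gu; rewrite gt in gt'.
  have sl := slope t c t01 cq (esym gt'); rewrite gu.
  by split=> lt; clear -sl gt' lt; nra.
pose S := [set t | 0 <= t <= 1 /\ forall u, 0 < u -> u <= t -> 0 < g u].
have S0 : S 0.
  split=> [|u u0 ul]; first by rewrite lexx ler01.
  by have := lt_le_trans u0 ul; rewrite ltxx.
have hs : has_sup S by split; [exists 0|exists 1 => t [/andP[]]].
pose c := sup S.
have c0 : 0 <= c by apply: ub_le_sup => //; case: hs.
have c1 : c <= 1 by apply: ge_sup => //; [exists 0|move=> t [/andP[]]].
have c01 : 0 <= c <= 1 by rewrite c0.
have near_sup d : 0 < d -> 0 < c -> exists s,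
    [/\ 0 <= s <= 1, s <= c, `|c - s| < d & 0 < g s].
  move=> d0 cp.
  (* The minimum with [c] keeps [s] positive, so that membership in [S] yields [0 < g s]. *)
  have mp : 0 < Num.min d c by rewrite lt_min d0.
  have [s Ss hs'] := sup_adherent mp hs.
  have sc : s <= c by apply: ub_le_sup => //; case: hs.
  have m1 : Num.min d c <= d by rewrite ge_min lexx.
  have m2 : Num.min d c <= c by rewrite ge_min lexx orbT.
  rewrite -/c in hs'; exists s; case: Ss => s01 Ss.
  by split=> //; [rewrite ger0_norm; lra|apply: Ss => //; lra].
(* If positivity of [g] continued to the right of [c], then [v] would be a point of [S] beyond its
   supremum. *)
have nostep d : 0 < d -> c < 1 -> (0 < c -> 0 < g c) ->
    (forall u, 0 <= u <= 1 -> `|c - u| < d -> c < u -> 0 < g u) -> False.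
  move=> d0 clt gc hd; pose v := Num.min (c + d / 2) 1.
  have v1 : v <= c + d / 2 by rewrite ge_min lexx.
  have v2 : v <= 1 by rewrite ge_min lexx orbT.
  have vc : c < v by rewrite lt_min clt andbT; lra.
  suff /(ub_le_sup (proj2 hs)) : S v by rewrite -/c leNgt vc.
  split=> [|u u0 uv]; first by apply/andP; split; lra.
  have [uc|cu|uc] := ltrgtP u c.
  - have [|s [_ Ss] us] := @sup_adherent _ S (c - u) _ hs; first by rewrite subr_gt0.
    by apply: Ss => //; rewrite -/c in us; lra.
  - by apply: hd => //; [lra|rewrite ltr0_norm; lra].
  - by rewrite uc; apply: gc; rewrite -uc.
have [gc|gc] := eqVneq (g c) 0.
  have [d d0 hd] := sgz c c01 gc.
  have [cp|cp] := ltrP 0 c.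
    have [s [s01 sc cs gs]] := near_sup d d0 cp.
    have [sc'|sc'] := ltrP s c; last first.
      have E : s = c by apply/le_anti; rewrite sc.
      by rewrite E gc ltxx in gs.
    by have [/(_ sc')] := hd s s01 cs; rewrite ltNge ltW.
  apply: (nostep d d0); rewrite ?(le_lt_trans cp) //; first by rewrite ltNge cp.
  by move=> u u01 ud cu; have [_] := hd u u01 ud; apply.
have [d d0 hd] := cont01_neq0 cg c01 gc.
have cp : 0 < c.
  by rewrite lt_neqAle c0 andbT; apply/eqP => E; move: gc; rewrite -E g0 eqxx.
have clt : c < 1.
  by rewrite lt_neqAle c1 andbT; apply/eqP => E; move: gc; rewrite E g1 eqxx.
have [s [s01 sc cs gs]] := near_sup d d0 cp.
have := hd s s01 cs; rewrite pmulr_lgt0 // => gc0.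
apply: (nostep d d0) => // u u01 ud _.
by have := hd u u01 ud; rewrite pmulr_rgt0.
Qed.

(** Subtracting the chord of [g] from [g] and from all pieces reduces to zero end values. *)
Lemma segment_two_point (R : realType) (g : R -> R) (q : seq (R * R)) :
  cont01 g ->
  (forall t, 0 <= t <= 1 -> exists2 c, c \in q & g t = c.1 + t * c.2) ->
  exists2 c, c \in q & g 0 <= c.1 /\ c.1 + c.2 <= g 1.
Proof.
move=> cg hq; pose h t := g t - (g 0 + t * (g 1 - g 0)).
pose q' := [seq (c.1 - g 0, c.2 - (g 1 - g 0)) | c <- q].
have [||||_ /mapP[c cq ->] /= [? ?]] := @segment_two_point0 R h q'.
- exact: cont01B cg (cont01_affine _ _).
- by rewrite /h; lra.
- by rewrite /h; lra.
- move=> t /hq[c cq gt]; exists (c.1 - g 0, c.2 - (g 1 - g 0)); first exact: map_f.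
  by rewrite /h gt /=; lra.
- by exists c => //; split; lra.
Qed.

(** * Farkas' lemma *)

(* Bartl's induction on the number of forms: if [a] cannot be dropped, a witness [z]
   with [z a > 0] allows replacing every form by its restriction to [ker a]. *)
Lemma farkas (F : realFieldType) k (L : seq 'cV[F]_k) (b : 'cV[F]_k) :
  (forall x : 'rV_k, (forall a, a \in L -> (x *m a) 0 0 <= 0) ->
     (x *m b) 0 0 <= 0) ->
  exists2 l : nat -> F, (forall i, 0 <= l i) &
    b = \sum_(i < size L) l i *: L`_i.
Proof.
move: {2}(size L) (erefl (size L)) => N.
elim: N L b => [|N IH] [|a L] //= b.
  move=> _ hb; exists (fun=> 0) => //; rewrite big_ord0.
  have bz j : b j 0 = 0.
    have := hb (delta_mx 0 j) ltac:(by []); have := hb (- delta_mx 0 j) ltac:(by []).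
    by rewrite mulNmx -rowE !mxE; lra.
  by apply/matrixP => i j; rewrite !ord1 bz mxE.
move=> [sL] hb.
have [hL|] := pselect (forall x : 'rV_k,
    (forall a, a \in L -> (x *m a) 0 0 <= 0) -> (x *m b) 0 0 <= 0).
  have [l l0 ->] := IH L b sL hL.
  exists (fun i => if i is j.+1 then l j else 0); first by case.
  by rewrite big_ord_recl /= scale0r add0r.
move=> /existsNP[z /not_implyP[hz /negP]]; rewrite -ltNge => zb.
have za : 0 < (z *m a) 0 0.
  rewrite ltNge; apply/negP => za; suff: (z *m b) 0 0 <= 0 by lra.
  by apply: hb => c; rewrite inE => /orP[/eqP-> //|]; exact: hz.
pose r (c : 'cV_k) := (z *m c) 0 0 / (z *m a) 0 0.
pose pr (c : 'cV_k) := c - r c *: a.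
have E (A B : 'M[F]_1) t : (A - t *: B) 0 0 = A 0 0 - t * B 0 0 by rewrite !mxE.
have prE (x : 'rV_k) c : (x *m pr c) 0 0 =
    ((x - ((x *m a) 0 0 / (z *m a) 0 0) *: z) *m c) 0 0.
  rewrite mulmxBr mulmxBl -scalemxAr -scalemxAl !E; congr (_ - _).
  by rewrite /r mulrAC [RHS]mulrAC [X in X / _]mulrC.
have [| |l l0 hl] := IH [seq pr c | c <- L] (pr b).
- by rewrite size_map.
- move=> x hx; rewrite prE; apply: hb => c; rewrite inE => /orP[/eqP->|cL].
    by rewrite mulmxBl -scalemxAl E divfK ?subrr // gt_eqF.
  by rewrite -prE; apply: hx; exact: map_f.
rewrite size_map in hl.
(* This is the coefficient of [a] in the combination; it is nonnegative because [z] is nonpositive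
   on [L] and positive on [a] and [b]. *)
have hr : r b - \sum_(i < size L) l i * r L`_i >= 0.
  rewrite subr_ge0; apply: (@le_trans _ _ 0).
    apply: sumr_le0 => i _; apply: mulr_ge0_le0 => //.
    apply: mulr_le0_ge0; last by rewrite invr_ge0 ltW.
    by apply: hz; exact: mem_nth.
  by rewrite ltW // divr_gt0.
exists (fun i => if i is j.+1 then l j else
    r b - \sum_(i < size L) l i * r L`_i); first by case.
rewrite big_ord_recl /= scalerBl scaler_suml -[LHS](subrK (r b *: a)) -/(pr b) hl.
rewrite addrC -addrA; congr (_ + _); rewrite addrC -sumrN -big_split /=.
apply: eq_bigr => i _; rewrite (nth_map 0) // scalerBr scalerA.
by rewrite addrC.
Qed.

(** * Continuity on subsets of R^n in coordinates *)

Definition cont_on (R : realType) n (A : set 'rV[R]_n) (h : 'rV[R]_n -> R) : Prop :=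
  forall x, A x -> forall e, 0 < e -> exists2 d, 0 < d &
    forall y, A y -> (forall i, `|x 0 i - y 0 i| < d) -> `|h x - h y| < e.

Lemma within_continuous_ballP (R : realType) n (A : set 'rV[R]_n)
    (M : pseudoMetricType R) (f : 'rV[R]_n -> M) :
  {within A, continuous f} <->
  forall x, A x -> forall e, 0 < e -> exists2 d, 0 < d &
    forall y, A y -> (forall i, `|x 0 i - y 0 i| < d) -> ball (f x) e (f y).
Proof.
rewrite subspace_continuousP; split=> cf x Ax.
  have /cvg_ballP fx := cf x Ax; move=> e e0.
  have /nbhs_ballP[d /= d0 hd] := fx e e0.
  exists d => // y Ay xy; apply: (hd y) => //.
  by split=> // i j; rewrite ord1; exact: xy.
apply/cvg_ballP => e e0; have [d d0 hd] := cf x Ax e e0.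
apply/nbhs_ballP; exists d => //= y [_ xy] Ay; apply: hd => // i; exact: xy.
Qed.

Lemma within_continuous_scalarP (R : realType) n (A : set 'rV[R]_n)
    (h : 'rV[R]_n -> R) : {within A, continuous h} <-> cont_on A h.
Proof. exact: within_continuous_ballP. Qed.

(** Supplies one radius that works for finitely many coordinates. *)
Lemma min_positive (R : realType) (I : finType) (P : I -> R -> Prop) :
  (forall i d d', d' <= d -> P i d -> P i d') ->
  (forall i, exists2 d, 0 < d & P i d) -> exists2 d, 0 < d & forall i, P i d.
Proof.
move=> mono /(_ _)/cid2-/all_sig2[d d0 hd].
exists (\big[Order.min/1]_i d i).
  by elim/big_ind: _ => // x y x0 y0; rewrite lt_min x0.
by move=> i; apply: mono (hd i); exact: bigmin_le_cond.
Qed.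

Lemma within_continuous_rowP (R : realType) m n (A : set 'rV[R]_m)
    (f : 'rV[R]_m -> 'rV[R]_n) :
  {within A, continuous f} <-> forall j, cont_on A (fun x => f x 0 j).
Proof.
rewrite within_continuous_ballP; split=> [cf j x Ax e e0|cf x Ax e e0].
  have [d d0 hd] := cf x Ax e e0; exists d => // y Ay xy.
  by have [_] := hd y Ay xy; apply.
have [|j|d d0 hd] := @min_positive R 'I_n (fun j d => forall y, A y ->
    (forall i, `|x 0 i - y 0 i| < d) -> `|f x 0 j - f y 0 j| < e).
- by move=> i d d' dd' hd y Ay xy; apply: hd => // k; exact: lt_le_trans (xy k) _.
- exact: cf.
by exists d => // y Ay xy; split=> // i j; rewrite ord1; exact: hd.
Qed.

Lemma cont_on_affine (R : realType) n (A : set 'rV[R]_n) p :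
  cont_on A (fun x => zaffine (R := R) (p : 'M[int]_(n, 1) * 'rV[int]_1) x 0 0).
Proof.
(* [M] exceeds a Lipschitz constant for the sup norm by 1: this makes it positive and the final
   estimate strict. *)
move=> x _ e e0; pose M := 1 + \sum_i `|(p.1 i 0)%:~R : R|.
have M0 : 0 < M.
  by rewrite /M ltr_wpDr // sumr_ge0.
exists (e / M) => [|y _ xy]; first exact: divr_gt0.
rewrite /zaffine !mxE [X in `|X|](_ : _ =
  \sum_i (x 0 i - y 0 i) * (p.1 i 0)%:~R); last first.
  rewrite opprD addrACA subrr addr0 -sumrB; apply: eq_bigr => i _.
  by rewrite !mxE mulrBl.
apply: le_lt_trans (ler_norm_sum _ _ _) _.
apply: (@le_lt_trans _ _ (e / M * (M - 1))).
  have -> : M - 1 = \sum_i `|(p.1 i 0)%:~R : R| by rewrite /M addrC addKr.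
  rewrite mulr_sumr; apply: ler_sum => i _; rewrite normrM.
  by apply: ler_wpM2r => //; exact/ltW/xy.
rewrite mulrBr divfK ?gt_eqF // mulr1.
by have : 0 < e / M by [exact: divr_gt0]; lra.
Qed.

(** * McNaughton functions as functions of row vectors *)

(** Extension by 0 outside the cube frees the arguments from the subtype; only values on the cube
    are ever used. *)
Definition mev (R : realType) n (f : mcnaughton R n) : 'rV[R]_n -> R :=
  valL_ 0 (mcn_val f).

Lemma mev_val (R : realType) n (f : mcnaughton R n) (u : cube R n) :
  mev f (set_val u) = f u.
Proof. by have := congr1 (@^~ u) (valLK 0 (mcn_val f)). Qed.

Lemma cubeP (R : realType) n (x : 'rV[R]_n) :
  cube R n x -> exists u : cube R n, set_val u = x.
Proof. by move=> cx; exists (SigSub (mem_set cx)). Qed.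

Lemma mcn_cont_on (R : realType) n (f : mcnaughton R n) : cont_on (cube R n) (mev f).
Proof.
have /asboolP[cf _] := mcn_valP f.
by apply/within_continuous_scalarP/subspace_valL_continuousP'.
Qed.

Lemma mcn_pieces (R : realType) n (f : mcnaughton R n) :
  exists s : seq ('M[int]_(n, 1) * 'rV[int]_1),
    forall x, cube R n x -> exists2 p, p \in s & mev f x = zaffine p x 0 0.
Proof.
have /asboolP[_ [s hs]] := mcn_valP f; exists s => _ /cubeP[u <-].
by rewrite mev_val.
Qed.

Lemma mcn_intro (R : realType) n (h : 'rV[R]_n -> R)
    (s : seq ('M[int]_(n, 1) * 'rV[int]_1)) :
  cont_on (cube R n) h ->
  (forall x, cube R n x -> exists2 p, p \in s & h x = zaffine p x 0 0) ->
  exists f : mcnaughton R n, forall x, cube R n x -> mev f x = h x.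
Proof.
move=> ch hs.
have mh : mcnaughton_pred (sigL (cube R n) h).
  apply/asboolP; split; last by exists s => u; apply: hs; exact: set_valP.
  by apply/subspace_sigL_continuousP/within_continuous_scalarP.
by exists (McNaughton mh) => _ /cubeP[u <-]; rewrite mev_val.
Qed.

Lemma mev_inj (R : realType) n (f g : mcnaughton R n) :
  (forall x, cube R n x -> mev f x = mev g x) -> f = g.
Proof.
by move=> fg; apply: mcn_eqP => u; rewrite -!mev_val; apply: fg; exact: set_valP.
Qed.

Section Evaluation.
Variables (R : realType) (n : nat).
Implicit Types (f g : mcnaughton R n) (x : 'rV[R]_n).

Lemma mevD f g x : cube R n x -> mev (f + g) x = mev f x + mev g x.
Proof. by case/cubeP=> u <-; rewrite !mev_val. Qed.
Lemma mevN f x : cube R n x -> mev (- f) x = - mev f x.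
Proof. by case/cubeP=> u <-; rewrite !mev_val. Qed.
Lemma mevB f g x : cube R n x -> mev (f - g) x = mev f x - mev g x.
Proof. by move=> cx; rewrite mevD // mevN. Qed.
Lemma mev0 x : cube R n x -> mev (0 : mcnaughton R n) x = 0.
Proof. by case/cubeP=> u <-; rewrite !mev_val. Qed.
Lemma mev_unit x : cube R n x -> mev (order_unit : mcnaughton R n) x = 1.
Proof. by case/cubeP=> u <-; rewrite !mev_val. Qed.
Lemma mev_join f g x :
  cube R n x -> mev (ljoin f g) x = Num.max (mev f x) (mev g x).
Proof. by case/cubeP=> u <-; rewrite !mev_val. Qed.
Lemma mev_meet f g x :
  cube R n x -> mev (lmeet f g) x = Num.min (mev f x) (mev g x).
Proof. by case/cubeP=> u <-; rewrite !mev_val. Qed.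
Lemma mevMn f k x : cube R n x -> mev (f *+ k) x = mev f x *+ k.
Proof.
by move=> cx; elim: k => [|k IH]; rewrite ?mulr0n ?mev0 // !mulrS mevD // IH.
Qed.
Lemma mevMz f (z : int) x : cube R n x -> mev (f *~ z) x = mev f x *~ z.
Proof. by case: z => k cx; rewrite ?NegzE ?mulrNz ?mevN // -!pmulrn mevMn. Qed.
Lemma mev_sum (T : Type) (r : seq T) (F : T -> mcnaughton R n) x : cube R n x ->
  mev (\sum_(i <- r) F i) x = \sum_(i <- r) mev (F i) x.
Proof.
move=> cx; elim: r => [|i r IH]; first by rewrite !big_nil mev0.
by rewrite !big_cons mevD // IH.
Qed.

Lemma zerosetP f x : zeroset f x <-> cube R n x /\ mev f x = 0.
Proof.
split=> [[u /= fu <-]|[/cubeP[u <-]]].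
  by rewrite mev_val; split=> //; exact: set_valP.
by rewrite mev_val => fu; exists u.
Qed.

Lemma mcn_affine_exists (p : 'M[int]_(n, 1) * 'rV[int]_1) :
  exists f, forall x, cube R n x -> mev f x = zaffine p x 0 0.
Proof.
apply: (@mcn_intro R n (fun x => zaffine p x 0 0) [:: p]).
  exact: cont_on_affine.
by move=> x _; exists p => //; exact: mem_head.
Qed.

Definition mcn_affine p : mcnaughton R n := projT1 (cid (mcn_affine_exists p)).

Lemma mev_affine p x : cube R n x -> mev (mcn_affine p) x = zaffine p x 0 0.
Proof. by move=> cx; rewrite /mcn_affine; case: cid => f /= ->. Qed.

End Evaluation.

(** * Order cells of affine pieces, domination and lattice interpolation *)

Local Notation aff p x := (zaffine p x 0 0).

Definition seg_convex (R : realType) n (A : set 'rV[R]_n) : Prop :=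
  forall a b t, A a -> A b -> 0 <= t <= 1 -> A (a + t *: (b - a)).

Section Pieces.
Variables (R : realType) (n : nat).
Implicit Types (p q r : 'M[int]_(n, 1) * 'rV[int]_1) (x y a b : 'rV[R]_n).
Implicit Types (s u L : seq ('M[int]_(n, 1) * 'rV[int]_1)).

Definition aff_sub p q : 'M[int]_(n, 1) * 'rV[int]_1 := (p.1 - q.1, p.2 - q.2).

Lemma aff_subE p q x : aff (aff_sub p q) x = aff p x - aff q x.
Proof. by rewrite /aff_sub zaffineB [LHS]mxE [X in _ + X]mxE. Qed.

Lemma aff_segment p a b t :
  aff p (a + t *: (b - a)) = aff p a + t * (aff p b - aff p a).
Proof.
rewrite /zaffine mulmxDl -scalemxAl mulmxBl.
have E (X Y Z : 'M[R]_1) : (X + t *: (Y - X) + Z) 0 0 =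
    (X + Z) 0 0 + t * ((Y + Z) 0 0 - (X + Z) 0 0) by rewrite !mxE; lra.
exact: E.
Qed.

Lemma cube_convex : seg_convex (cube R n).
Proof.
move=> a b t ca cb /andP[t0 t1] i; rewrite !mxE.
have := ca i; have := cb i => /andP[? ?] /andP[? ?].
by apply/andP; split; nra.
Qed.

(** Along the segment from [a] to [b], [h] becomes a function on [0,1] and each piece becomes a pair
    of initial value and increment. *)
Lemma two_point (A : set 'rV[R]_n) (h : 'rV[R]_n -> R) s a b :
  seg_convex A -> cont_on A h ->
  (forall x, A x -> exists2 p, p \in s & h x = aff p x) ->
  A a -> A b -> exists2 r, r \in s & h a <= aff r a /\ aff r b <= h b.
Proof.
move=> cA ch hs Aa Ab; pose g t := h (a + t *: (b - a)).
pose q := [seq (aff r a, aff r b - aff r a : R) | r <- s].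
have [||_ /mapP[r rs ->] /=] := @segment_two_point R g q.
- move=> t t01 e e0; have [d d0 hd] := ch _ (cA a b t Aa Ab t01) e e0.
  have [i d1 d2 d21 h1 v v01 tv|i|d' d'0 hd'] := @min_positive R 'I_n (fun i d' =>
      forall v, 0 <= v <= 1 -> `|t - v| < d' ->
      `|(a 0 i + t * (b 0 i - a 0 i)) - (a 0 i + v * (b 0 i - a 0 i))| < d).
  + exact/(h1 v v01)/(lt_le_trans tv).
  + exact: cont01_affine.
  exists d' => // v v01 tv; apply: hd; first exact: cA.
  by move=> i; rewrite !mxE; exact: hd'.
- move=> t t01; have [r rs hr] := hs _ (cA a b t Aa Ab t01).
  exists (aff r a, aff r b - aff r a); first exact: map_f.
  by rewrite /g hr aff_segment.
rewrite /g scale0r scale1r addr0 (addrC a) subrK => -[ha hb].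
by exists r => //; split; lra.
Qed.

(** For fixed [x], the points [y] form a closed convex cell: ties at [x] stay ties, while strict
    inequalities may degenerate to ties. Hence the relation is not symmetric. *)
Definition le_on u x y : Prop :=
  {in u &, forall r r', aff r x <= aff r' x -> aff r y <= aff r' y}.

Lemma le_on_subset u s x y : {subset s <= u} -> le_on u x y -> le_on s x y.
Proof. by move=> su xy r r' /su ru /su r'u; exact: xy. Qed.

Lemma le_on_convex u x : seg_convex (le_on u x).
Proof.
move=> a b t xa xb /andP[t0 t1] r r' ru r'u rr'; rewrite !aff_segment.
by have := xa r r' ru r'u rr'; have := xb r r' ru r'u rr'; nra.
Qed.

(* If [h x0 = p x0] but [h x != p x], the two-point property yields a piece that
   changes order with [p] between [x0] and [x]. *)
Lemma piece_on_cell (A : set 'rV[R]_n) (h : 'rV[R]_n -> R) s x0 x p :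
  seg_convex A -> cont_on A h ->
  (forall x, A x -> exists2 p, p \in s & h x = aff p x) ->
  A x0 -> A x -> le_on s x0 x -> p \in s -> h x0 = aff p x0 -> h x = aff p x.
Proof.
move=> cA ch hs Ax0 Ax x0x ps hp; apply/le_anti/andP; split.
  have [r rs [rx rx0]] := two_point cA ch hs Ax Ax0.
  by rewrite hp in rx0; apply: le_trans rx _; exact: x0x.
have [r rs [rx0 rx]] := two_point cA ch hs Ax0 Ax.
by rewrite hp in rx0; apply: le_trans _ rx; exact: x0x.
Qed.

Let pairs u := [seq (r, r') | r <- u, r' <- u].

(** The code lives in a finite type, so it can index a finite covering of the cube by cells. *)
Definition order_code u x : (size (pairs u)).-tuple bool :=
  [tuple of [seq aff z.1 x <= aff z.2 x | z <- in_tuple (pairs u)]].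

Lemma order_code_le_on u x y : order_code u x = order_code u y -> le_on u x y.
Proof.
move=> /(congr1 val)/eq_in_map E r r' ru r'u rr'.
have /E /= <- // : (r, r') \in pairs u by exact: allpairs_f.
Qed.

Definition cell_ineqs u x :=
  [seq aff_sub z.1 z.2 | z <- pairs u & aff z.1 x <= aff z.2 x].

Lemma cell_ineqsP u x y :
  (forall p, p \in cell_ineqs u x -> aff p y <= 0) <-> le_on u x y.
Proof.
split=> [h r r' ru r'u rr'|h _ /mapP[[r r'] + ->]].
  rewrite -subr_le0 -aff_subE; apply: h.
  by apply/mapP; exists (r, r'); rewrite // mem_filter rr' allpairs_f.
rewrite mem_filter => /andP[/= rr' /allpairsP[[z z'] /= [zu z'u [E E']]]].
by rewrite aff_subE subr_le0; subst; exact: h.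
Qed.

(* The inequalities are homogenized with an extra coordinate [t]; since the cube is
   bounded, its homogenization meets [t = 0] only at the origin. *)
Lemma polytope_dominated L p q :
  (forall x, cube R n x -> (forall l, l \in L -> aff l x <= 0) ->
     0 <= aff p x /\ (aff p x = 0 -> aff q x <= 0)) ->
  exists k : nat, forall x, cube R n x ->
    (forall l, l \in L -> aff l x <= 0) -> aff q x <= k%:R * aff p x.
Proof.
move=> hpq.
pose hom (l : 'M[int]_(n, 1) * 'rV[int]_1) : 'cV[R]_(n + 1) :=
  col_mx (map_mx intr l.1) (map_mx intr l.2).
have homE x t l : (row_mx x t%:M *m hom l) 0 0 =
    (x *m map_mx intr l.1) 0 0 + t * (l.2 0 0)%:~R.
  by rewrite mul_row_col mul_scalar_mx !mxE.
have homZ x t l : (row_mx (t *: x) t%:M *m hom l) 0 0 = t * aff l x.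
  by rewrite homE -scalemxAl /zaffine !mxE mulrDr.
have hom1 x l : (row_mx x 1%:M *m hom l) 0 0 = aff l x.
  by rewrite -{1}[x]scale1r homZ mul1r.
(* With the form for [0 <= t], these are the homogenized inequalities of the cube, [0 <= x_i] and
   [x_i <= t]. *)
pose lo i : 'M[int]_(n, 1) * 'rV[int]_1 := (- delta_mx i 0, 0).
pose up i : 'M[int]_(n, 1) * 'rV[int]_1 := (delta_mx i 0, - 1%:M).
pose box := (0, - 1%:M) :: [seq lo i | i <- enum 'I_n] ++ [seq up i | i <- enum 'I_n].
have homlo x t i : (row_mx x t%:M *m hom (lo i)) 0 0 = - x 0 i.
  rewrite homE /= map_mxN map_delta_mx mulmxN -colE !mxE mulr0 addr0 //.
have homup x t i : (row_mx x t%:M *m hom (up i)) 0 0 = x 0 i - t.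
  by rewrite homE /= map_delta_mx -colE !mxE /= mulrN1z mulrN1.
have homt x t : (row_mx x t%:M *m hom (0, - 1%:M)) 0 0 = - t.
  by rewrite homE /= map_mx0 mulmx0 !mxE /= mulrN1z add0r mulrN1.
(* Adding the constraint [p <= 0] cuts the polytope down to the zeros of [p], where [q <= 0] by
   hypothesis; Farkas then makes [q] a nonnegative combination of the forms. *)
have [v hv|l l0 hl] := @farkas R (n + 1) [seq hom l | l <- p :: L ++ box] (hom q).
  have -> : v = row_mx (lsubmx v) (rsubmx v 0 0)%:M.
    by rewrite -mx11_scalar hsubmxK.
  have {}hv l : l \in p :: L ++ box ->
      (row_mx (lsubmx v) (rsubmx v 0 0)%:M *m hom l) 0 0 <= 0.
    by move=> lL; rewrite -mx11_scalar hsubmxK; apply: hv; exact: map_f.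
  move: (lsubmx v) (rsubmx v 0 0) hv => x t hv.
  have hbox l : l \in box -> (row_mx x t%:M *m hom l) 0 0 <= 0.
    by move=> lb; apply: hv; rewrite inE mem_cat lb !orbT.
  have t0 : 0 <= t by rewrite -oppr_le0 -(homt x); apply: hbox; exact: mem_head.
  have xt i : 0 <= x 0 i <= t.
    rewrite -oppr_le0 -(homlo x t) -[_ <= t]subr_le0 -(homup x t).
    by apply/andP; split; apply: hbox;
      rewrite inE mem_cat map_f ?mem_enum // !orbT.
  have [t1|t1] := eqVneq t 0.
    suff -> : x = 0 by rewrite t1 -[0 : 'rV_n](scale0r 0) homZ mul0r.
    by apply/rowP => i; rewrite mxE; have := xt i; rewrite t1 => ?; lra.
  have tp : 0 < t by rewrite lt_neqAle eq_sym t1.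
  have [y xE] : exists y, x = t *: y.
    by exists (t^-1 *: x); rewrite scalerA divff // scale1r.
  have cy : cube R n y.
    by move=> i; have := xt i; rewrite xE mxE pmulr_rge0 // ger_pMr.
  have hy l : l \in p :: L -> aff l y <= 0.
    move=> lL; rewrite -(pmulr_rle0 _ tp) -homZ -xE; apply: hv.
    by rewrite -cat_cons mem_cat lL.
  have hyL l : l \in L -> aff l y <= 0.
    by move=> lL; apply: hy; rewrite inE lL orbT.
  rewrite xE homZ pmulr_rle0 //; have [p0] := hpq y cy hyL.
  by apply; apply/le_anti; rewrite p0 andbT; apply: hy; exact: mem_head.
(* [l 0] is the coefficient of [p]; all other terms are nonpositive on the polytope. *)
exists (Num.bound (l 0%N)) => x cx hx; have [p0 _] := hpq x cx hx.
rewrite -(hom1 x q) hl size_map mulmx_sumr summxE big_ord_recl /= .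
rewrite -scalemxAr [X in X + _]mxE hom1 -[leRHS]addr0; apply: lerD.
  by apply: ler_wpM2r => //; rewrite ltW // archi_boundP.
apply: sumr_le0 => i _; rewrite -scalemxAr mxE.
apply: mulr_ge0_le0 => //; rewrite /bump /= (nth_map p) ?ltn_ord // hom1.
have : nth p (L ++ box) i \in L ++ box by rewrite mem_nth // ltn_ord.
rewrite mem_cat => /orP[/hx //|].
rewrite inE mem_cat -(hom1 x) => /or3P[/eqP->|/mapP[j _ ->]|/mapP[j _ ->]].
- by rewrite homt oppr_le0.
- by rewrite homlo oppr_le0; case/andP: (cx j).
- by rewrite homup subr_le0; case/andP: (cx j).
Qed.

Lemma uniform_bound (T : finType) (P : T -> nat -> Prop) :
  (forall t k k', (k <= k')%N -> P t k -> P t k') ->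
  (forall t, exists k, P t k) -> exists k, forall t, P t k.
Proof.
move=> mono /(_ _)/cid-/all_sig[k hk]; exists (\max_t k t)%N => t.
by apply: mono (hk t); exact: leq_bigmax.
Qed.

(** On a cell for the pieces of both functions, each of [f] and [g] is a single affine function, so
    [polytope_dominated] gives a bound there; the finitely many bounds have a maximum. *)
Lemma mcn_dominated (f g : mcnaughton R n) :
  (forall x, cube R n x -> 0 <= mev f x) ->
  (forall x, cube R n x -> mev f x = 0 -> mev g x <= 0) ->
  exists k : nat, forall x, cube R n x -> mev g x <= k%:R * mev f x.
Proof.
move=> f0 fg; have [s hs] := mcn_pieces f; have [t ht] := mcn_pieces g.
pose u := s ++ t.
have su : {subset s <= u} by move=> z zs; rewrite mem_cat zs.
have tu : {subset t <= u} by move=> z zs; rewrite mem_cat zs orbT.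
have [w k k' kk' hk x cx wx|w|k hk] := @uniform_bound _ (fun w k =>
    forall x, cube R n x -> order_code u x = w -> mev g x <= k%:R * mev f x).
- by apply: le_trans (hk x cx wx) _; rewrite ler_wpM2r ?f0 // ler_nat.
- have [[x0 [cx0 wx0]]|noc] := pselect (exists x, cube R n x /\ order_code u x = w);
    last by exists 0%N => x cx wx; case: noc; exists x.
  have [p ps fp] := hs x0 cx0; have [q qt gq] := ht x0 cx0.
  have fE x : cube R n x -> le_on u x0 x -> mev f x = aff p x.
    move=> cx xx0; apply: (piece_on_cell (@cube_convex) (@mcn_cont_on R n f) hs
      cx0 cx _ ps fp); exact: le_on_subset xx0.
  have gE x : cube R n x -> le_on u x0 x -> mev g x = aff q x.
    move=> cx xx0; apply: (piece_on_cell (@cube_convex) (@mcn_cont_on R n g) ht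
      cx0 cx _ qt gq); exact: le_on_subset xx0.
  have [x cx /cell_ineqsP hx|k hk] := @polytope_dominated (cell_ineqs u x0) p q.
    by rewrite -fE // -gE //; split; [exact: f0|exact: fg].
  exists k => x cx wx; have xx0 : le_on u x0 x.
    by apply: order_code_le_on; rewrite wx0.
  by rewrite fE // gE //; apply: hk => //; exact/cell_ineqsP.
by exists k => x cx; exact: hk.
Qed.

(** For fixed [i], the meet over all [j] of the given functions is at least [h] on [C i] and at most
    [h] on every [C j]. The join of these meets over all [i] equals [h] on every [C i]. *)
Lemma lattice_interpolation (T : finType) (C : T -> set 'rV[R]_n)
    (K : set (mcnaughton R n)) (h : 'rV[R]_n -> R) :
  (forall i, C i `<=` cube R n) -> K !=set0 ->
  (forall f g, K f -> K g -> K (ljoin f g)) ->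
  (forall f g, K f -> K g -> K (lmeet f g)) ->
  (forall i j, exists f, [/\ K f, forall x, C i x -> h x <= mev f x
     & forall x, C j x -> mev f x <= h x]) ->
  exists2 g, K g & forall i x, C i x -> mev g x = h x.
Proof.
move=> cC [f0 Kf0] KU KI hr.
have inner i : exists g, [/\ K g, forall x, C i x -> h x <= mev g x
    & forall j x, C j x -> mev g x <= h x].
  suff [g [Kg hi hj]] : exists g, [/\ K g, forall x, C i x -> h x <= mev g x
      & forall j, j \in enum T -> forall x, C j x -> mev g x <= h x].
    by exists g; split=> // j; apply: hj; rewrite mem_enum.
  elim: (enum T) => [|j l [g [Kg hi hj]]].
    by have [r [Kr ri _]] := hr i i; exists r.
  have [r [Kr ri rj]] := hr i j; exists (lmeet r g); split; first exact: KI.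
    by move=> x Cx; rewrite mev_meet ?le_min ?ri ?hi //; exact: cC Cx.
  move=> j'; rewrite inE => j'l x Cx; rewrite mev_meet ?ge_min; last exact: cC Cx.
  by case/orP: j'l Cx => [/eqP-> /rj->//|/hj h' /h' ->]; rewrite orbT.
suff [g [Kg hj hi]] : exists g, [/\ K g, forall j x, C j x -> mev g x <= h x
    & forall i, i \in enum T -> forall x, C i x -> h x <= mev g x].
  exists g => // i x Cx; apply/le_anti; rewrite (hj i x Cx) (hi i) //.
  by rewrite mem_enum.
(* Without cells any member of [K] serves; otherwise the join starts from the function of [i0],
   since an empty join has no value. *)
case E : (enum T) => [|i0 l0].
  exists f0; split=> // j; have : j \in enum T by rewrite mem_enum.
  by rewrite E.
elim: {E}(i0 :: l0) => [|i l [g [Kg hj hi]]].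
  by have [g [Kg hi hj]] := inner i0; exists g.
have [r [Kr ri rj]] := inner i; exists (ljoin r g); split; first exact: KU.
  by move=> j x Cx; rewrite mev_join ?ge_max ?(rj _ _ Cx) ?(hj _ _ Cx) //; exact: cC Cx.
move=> i'; rewrite inE => i'l x Cx; rewrite mev_join ?le_max; last exact: cC Cx.
by case/orP: i'l Cx => [/eqP-> /ri->//|/hi h' /h' ->]; rewrite orbT.
Qed.

End Pieces.

(** * Composition with McNaughton maps and generation by the coordinates *)

Lemma ul_hom0 (G H : ulgroupType) (phi : G -> H) : ul_hom phi -> phi 0 = 0.
Proof. by move=> /ul_homB/(_ 0 0); rewrite !subrr. Qed.

Section Composition.
Variables (R : realType).

(** Choosing one scalar piece per coordinate gives one vector-valued piece, and there are finitely
    many choices; concatenating the lists lets all coordinates choose from the same one. *)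
Lemma row_pieces m n (A : set 'rV[R]_n) (b : 'I_m -> 'rV[R]_n -> R) :
  (forall i, exists s : seq ('M[int]_(n, 1) * 'rV[int]_1),
     forall x, A x -> exists2 p, p \in s & b i x = aff p x) ->
  exists S : seq ('M[int]_(n, m) * 'rV[int]_m),
    forall x, A x -> exists2 p, p \in S & \row_i b i x = zaffine p x.
Proof.
move=> /(_ _)/cid-/all_sig[s hs]; pose t := flatten [seq s i | i <- enum 'I_m].
pose glue (phi : {ffun 'I_m -> 'I_(size t)}) : 'M[int]_(n, m) * 'rV[int]_m :=
  (\matrix_(k, i) (t`_(phi i)).1 k 0, \row_i (t`_(phi i)).2 0 0).
exists [seq glue phi | phi <- enum {ffun 'I_m -> 'I_(size t)}] => x Ax.
have /(_ _)/cid-/all_sig[phi hphi] i :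
    exists k : 'I_(size t), b i x = aff t`_k x.
  have [p ps bp] := hs i x Ax.
  have pt : p \in t by apply/flattenP; exists (s i); rewrite // map_f ?mem_enum.
  have kt : (index p t < size t)%N by rewrite index_mem.
  by exists (Ordinal kt); rewrite /= nth_index.
exists (glue [ffun i => phi i]); first by rewrite map_f ?mem_enum.
apply/rowP => i; rewrite mxE hphi /zaffine !mxE ffunE; congr (_ + _).
by apply: eq_bigr => k _; rewrite !mxE ffunE.
Qed.

(** Truncation to the interval between 0 and the unit makes any tuple of functions define a map into
    the cube. Being a lattice term, it commutes with homomorphisms. *)
Definition clip (G : ulgroupType) (g : G) : G := lmeet (ljoin g 0) order_unit.

Lemma clip_hom (G H : ulgroupType) (phi : G -> H) g :
  ul_hom phi -> phi (clip g) = clip (phi g).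
Proof.
move=> hphi; have phi0 := ul_hom0 hphi.
by case: hphi => _ pU pI p1; rewrite /clip pI pU p1 phi0.
Qed.

Lemma mev_clip n (f : mcnaughton R n) x :
  cube R n x -> mev (clip f) x = Num.min (Num.max (mev f x) 0) 1.
Proof. by move=> cx; rewrite mev_meet // mev_join // mev_unit // mev0. Qed.

Definition mcn_map m n (b : 'I_m -> mcnaughton R n) (x : 'rV[R]_n) : 'rV[R]_m :=
  \row_i mev (clip (b i)) x.

Lemma mcn_map_cube m n (b : 'I_m -> mcnaughton R n) x :
  cube R n x -> cube R m (mcn_map b x).
Proof.
move=> cx i; rewrite mxE mev_clip // le_min ge_min lexx ler01 le_max lexx.
by rewrite !orbT.
Qed.

Lemma mcn_map_zmap m n (b : 'I_m -> mcnaughton R n) (A : set 'rV[R]_n) :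
  A `<=` cube R n -> is_zmap A (mcn_map b).
Proof.
move=> Ac; split.
  apply/within_continuous_rowP => i x Ax e e0.
  have [d d0 hd] := @mcn_cont_on R n (clip (b i)) _ (Ac x Ax) _ e0.
  by exists d => // y Ay xy; rewrite !mxE; apply: hd => //; exact: Ac.
apply: (@row_pieces m n A (fun i => mev (clip (b i)))) => i.
have [s hs] := mcn_pieces (clip (b i)); exists s => x Ax; exact: hs (Ac x Ax).
Qed.

Lemma mcn_comp_exists m n (b : 'I_m -> mcnaughton R n) (f : mcnaughton R m) :
  exists g : mcnaughton R n,
    forall x, cube R n x -> mev g x = mev f (mcn_map b x).
Proof.
have [cb [S hS]] := @mcn_map_zmap m n b (cube R n) (fun _ => id).
have [s hs] := mcn_pieces f.
pose comp (P : 'M[int]_(n, m) * 'rV[int]_m) (p : 'M[int]_(m, 1) * 'rV[int]_1) :=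
  (P.1 *m p.1, P.2 *m p.1 + p.2).
apply: (@mcn_intro R n _ [seq comp P p | P <- S, p <- s]) => [x cx e e0|x cx].
  have [d d0 hd] := @mcn_cont_on R m f _ (mcn_map_cube b cx) _ e0.
  move/within_continuous_rowP: cb => cb.
  have [i d1 d2 d21 h1 y cy xy|i|d' d'0 hd'] := @min_positive R 'I_m (fun i d' =>
      forall y, cube R n y -> (forall k, `|x 0 k - y 0 k| < d') ->
        `|mcn_map b x 0 i - mcn_map b y 0 i| < d).
  + by apply: h1 => // k; exact: lt_le_trans (xy k) _.
  + exact: cb.
  exists d' => // y cy xy; apply: hd; first exact: mcn_map_cube.
  by move=> i; exact: hd'.
have [P PS bP] := hS x cx; have [p ps fp] := hs _ (mcn_map_cube b cx).
exists (comp P p); first by apply/allpairsP; exists (P, p).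
by rewrite fp bP /zaffine /comp /= !map_mxD !map_mxM mulmxDl -mulmxA addrA //.
Qed.

Definition mcn_comp m n (b : 'I_m -> mcnaughton R n) (f : mcnaughton R m) :
  mcnaughton R n := projT1 (cid (mcn_comp_exists b f)).

Lemma mev_comp m n (b : 'I_m -> mcnaughton R n) f x :
  cube R n x -> mev (mcn_comp b f) x = mev f (mcn_map b x).
Proof. by move=> cx; rewrite /mcn_comp; case: cid => g /= ->. Qed.

Lemma mcn_comp_hom m n (b : 'I_m -> mcnaughton R n) : ul_hom (mcn_comp b).
Proof.
split=> [f g|f g|f g|]; apply: mev_inj => x cx; have cbx := mcn_map_cube b cx.
- by rewrite mevD // !mev_comp // mevD.
- by rewrite mev_join // !mev_comp // mev_join.
- by rewrite mev_meet // !mev_comp // mev_meet.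
- by rewrite mev_comp // !mev_unit.
Qed.

Definition mcn_coord n (i : 'I_n) : mcnaughton R n := mcn_affine R (delta_mx i 0, 0).

Lemma mev_coord n (i : 'I_n) x : cube R n x -> mev (mcn_coord i) x = x 0 i.
Proof.
move=> cx; rewrite mev_affine // /zaffine map_delta_mx map_mx0 addr0.
by rewrite -colE mxE.
Qed.

Lemma clip_coord n (i : 'I_n) : clip (mcn_coord i) = mcn_coord i.
Proof.
apply: mev_inj => x cx; rewrite mev_clip // mev_coord //.
by have /andP[x0 x1] := cx i; rewrite (max_idPl x0) (min_idPl x1).
Qed.

Lemma mcn_comp_coord m n (b : 'I_m -> mcnaughton R n) i :
  mcn_comp b (mcn_coord i) = clip (b i).
Proof.
apply: mev_inj => x cx; rewrite mev_comp // mev_coord; last exact: mcn_map_cube.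
by rewrite mxE.
Qed.

Lemma mcn_affineE n (p : 'M[int]_(n, 1) * 'rV[int]_1) :
  mcn_affine R p = \sum_i mcn_coord i *~ p.1 i 0 + order_unit *~ p.2 0 0.
Proof.
apply: mev_inj => x cx; rewrite mevD // mev_sum // mevMz // mev_unit // mev_affine //.
rewrite /zaffine !mxE; congr (_ + _); apply: eq_bigr => i _.
by rewrite mevMz // mev_coord // !mxE mulrzr.
Qed.

(** The equalizer [K] is closed under all operations and contains the coordinates and the unit,
    hence every integral affine function. Such functions interpolate [f] between any two cells, so
    [f] lies in [K]. *)
Lemma mcn_hom_ext n (H : ulgroupType) (phi psi : mcnaughton R n -> H) :
  ul_hom phi -> ul_hom psi ->
  (forall i, phi (mcn_coord i) = psi (mcn_coord i)) -> phi =1 psi.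
Proof.
move=> hphi hpsi coord f; pose K := [set g | phi g = psi g].
have [phiD phiU phiI phi1] := hphi; have [psiD psiU psiI psi1] := hpsi.
have K0 : K 0 by rewrite /K /= !ul_hom0.
have KD g g' : K g -> K g' -> K (g + g').
  by rewrite /K /= phiD psiD => -> ->.
have KN g : K g -> K (- g).
  by move=> Kg; rewrite /K /= -[- g]sub0r !(ul_homB hphi, ul_homB hpsi) K0 Kg.
have KMz g z : K g -> K (g *~ z).
  move=> Kg; have KMn k : K (g *+ k).
    by elim: k => [|k IH]; rewrite ?mulr0n // mulrS; exact: KD.
  by case: z => k; rewrite ?NegzE ?mulrNz -pmulrn //; exact: KN.
have Kaff p : K (mcn_affine R p).
  rewrite mcn_affineE; apply: (KD); last by apply: (KMz); rewrite /K /= phi1.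
  by elim/big_ind: _ => // i _; apply: KMz; exact: coord.
have [s hs] := mcn_pieces f.
(* A sample point in each cell; the origin is a dummy value for codes that do not occur. *)
have /(_ _)/cid-/all_sig[a ha] w : exists a, cube R n a /\
    forall x, cube R n x -> order_code s x = w -> order_code s a = w.
  have [[a []]|noa] := pselect (exists x, cube R n x /\ order_code s x = w).
    by exists a.
  exists 0; split=> [i|x cx xw]; first by rewrite mxE lexx ler01.
  by case: noa; exists x.
have [||||i j|g Kg hg] := @lattice_interpolation R n _
    (fun w => [set x | cube R n x /\ order_code s x = w]) K (mev f).
- by move=> w x [].
- by exists 0.
- by move=> g g'; rewrite /K /= phiU psiU => -> ->.
- by move=> g g'; rewrite /K /= phiI psiI => -> ->.
- have cube_cv := @cube_convex R n; have cf := @mcn_cont_on R n f.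
  have transfer w x : cube R n x -> order_code s x = w -> le_on s (a w) x /\
      exists p, [/\ p \in s, mev f (a w) = aff p (a w) & mev f x = aff p x].
    move=> cx xw; have [ca aw] := ha w.
    have ax : le_on s (a w) x by apply: order_code_le_on; rewrite (aw x).
    split=> //; have [p ps fp] := hs _ ca; exists p; split=> //.
    exact: (piece_on_cell cube_cv cf hs ca cx ax ps fp).
  (* The comparisons of [r] with the active pieces at the two sample points persist on the two
     cells. *)
  have [r rs [ri rj]] := two_point cube_cv cf hs (proj1 (ha i)) (proj1 (ha j)).
  exists (mcn_affine R r); split=> // x [cx xw]; rewrite mev_affine //.
    have [ax [p [ps fa ->]]] := transfer i x cx xw.
    by rewrite fa in ri; exact: ax.
  have [ax [p [ps fa ->]]] := transfer j x cx xw.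
  by rewrite fa in rj; exact: ax.
suff -> : f = g by [].
by apply: mev_inj => x cx; rewrite (hg (order_code s x)).
Qed.

End Composition.

(** * Extension of piecewise affine functions from a zeroset *)

Section Extension.
Variables (R : realType) (n : nat).
Implicit Types (f g : mcnaughton R n) (x : 'rV[R]_n).
Implicit Types (s u L : seq ('M[int]_(n, 1) * 'rV[int]_1)).

Definition mcn_abs f : mcnaughton R n := ljoin f (- f).

Lemma mev_abs f x : cube R n x -> mev (mcn_abs f) x = `|mev f x|.
Proof. by move=> cx; rewrite mev_join // mevN // maxrN. Qed.

(** The witness is the sum of the positive parts of the members of [L]. *)
Lemma mcn_ineqs_zero L : exists f, forall x, cube R n x ->
  0 <= mev f x /\ (mev f x = 0 <-> forall l, l \in L -> aff l x <= 0).
Proof.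
elim: L => [|l L [f hf]].
  by exists 0 => x cx; rewrite mev0.
exists (ljoin (mcn_affine R l) 0 + f) => x cx.
have [f0 fz] := hf x cx.
rewrite mevD // mev_join // mev0 // mev_affine //.
have m0 : 0 <= Num.max (aff l x) 0 by rewrite le_max lexx orbT.
split; first exact: addr_ge0.
split=> [/eqP|h].
  rewrite paddr_eq0 // => /andP[/eqP/max_idPr lx /eqP/fz hL] l'.
  by rewrite inE => /orP[/eqP->|/hL].
rewrite (max_idPr _) ?h ?mem_head // add0r; apply/fz => l' l'L.
by apply: h; rewrite inE l'L orbT.
Qed.

(** For two cells with pieces [p_i], [p_j] and nonnegative functions [d_i], [d_j] vanishing on them,
    [p_j + k d_j] equals [h] on cell [j] and, for large [k], is at least [h = p_i] on cell [i].
    Lattice interpolation glues these functions. *)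
Lemma mcn_extension (f0 : mcnaughton R n) (h : 'rV[R]_n -> R) s :
  cont_on (zeroset f0) h ->
  (forall x, zeroset f0 x -> exists2 p, p \in s & h x = aff p x) ->
  exists g, forall x, zeroset f0 x -> mev g x = h x.
Proof.
move=> ch hs; have [t ht] := mcn_pieces f0; pose u := s ++ t.
have su : {subset s <= u} by move=> z zs; rewrite mem_cat zs.
have tu : {subset t <= u} by move=> z zs; rewrite mem_cat zs orbT.
have zc x : zeroset f0 x -> cube R n x by case/zerosetP.
(* The zeroset of [pd.2] is convex, inside that of [f0], and contains its points
   with order code [w]; by convexity [h] equals the single piece [pd.1] on it. *)
have piece w : exists pd : ('M[int]_(n, 1) * 'rV[int]_1) * mcnaughton R n,
    [/\ forall x, cube R n x -> 0 <= mev pd.2 x,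
        forall x, cube R n x -> mev pd.2 x = 0 ->
          zeroset f0 x /\ h x = aff pd.1 x
      & forall x, zeroset f0 x -> order_code u x = w -> mev pd.2 x = 0].
  have [[a [za aw]]|noa] := pselect (exists x, zeroset f0 x /\ order_code u x = w);
    last first.
    (* For a code that does not occur, the order-unit serves because it has no zeros. *)
    exists (0, order_unit); split=> [x cx|x cx|x zx xw] /=; last by case: noa; exists x.
      by rewrite mev_unit.
    by rewrite mev_unit // => /eqP; rewrite oner_eq0.
  have [p ps hp] := hs a za; have [q qt f0q] := ht a (zc a za).
  have [d hd] := mcn_ineqs_zero (cell_ineqs u a).
  have f0E x : cube R n x -> le_on u a x -> mev f0 x = aff q x.
    move=> cx ax; apply: (piece_on_cell (@cube_convex R n) (@mcn_cont_on R n f0) ht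
      (zc a za) cx _ qt f0q); exact: le_on_subset ax.
  pose A := [set x | zeroset f0 x /\ le_on u a x].
  have cA : seg_convex A.
    move=> x y l [zx ax] [zy ay] l01.
    have cx := zc x zx; have cy := zc y zy.
    have cl := cube_convex cx cy l01; have al := le_on_convex ax ay l01.
    split=> //; apply/zerosetP; split=> //.
    rewrite f0E // aff_segment -!f0E //.
    move/zerosetP: zx => [_ ->]; move/zerosetP: zy => [_ ->].
    by rewrite subrr mulr0 addr0.
  exists (p, d + mcn_abs f0); split=> [x cx|x cx|x zx xw] /=.
  - by rewrite mevD // addr_ge0 ?mev_abs //; case: (hd x cx).
  - have [d0 dz] := hd x cx; rewrite mevD // mev_abs // => /eqP.
    rewrite paddr_eq0 // normr_eq0 => /andP[/eqP/dz/cell_ineqsP ax /eqP fx].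
    have zx : zeroset f0 x by apply/zerosetP.
    split=> //; apply: (@piece_on_cell R n A h s a x p) => //.
    + by move=> y [zy _] e e0; have [d' d'0 hd'] := ch y zy e e0;
        exists d' => // z [zz _]; exact: hd'.
    + by move=> y [zy _]; exact: hs.
    + by split=> // r r'.
    + exact: le_on_subset ax.
  - have [_ dz] := hd x (zc x zx); move/zerosetP: (zx) => [cx fx].
    rewrite mevD // mev_abs // fx normr0 addr0; apply/dz/cell_ineqsP.
    by apply: order_code_le_on; rewrite aw xw.
have [pd hpd] := choice piece.
have [||||i j|g _ hg] := @lattice_interpolation R n _
    (fun w => [set x | zeroset f0 x /\ order_code u x = w]) setT h.
- by move=> w x [/zc].
- by exists 0.
- by [].
- by [].
- have [di0 diz dic] := hpd i; have [dj0 djz djc] := hpd j.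
  (* Where [d_i] and [d_j] both vanish, both pieces equal [h], so their difference is dominated by a
     multiple of [d_i + d_j]. *)
  have [||k hk] := @mcn_dominated R n ((pd i).2 + (pd j).2)
      (mcn_affine R (aff_sub (pd i).1 (pd j).1)).
  + by move=> x cx; rewrite mevD // addr_ge0 ?di0 ?dj0.
  + move=> x cx; rewrite mevD // => /eqP.
    rewrite paddr_eq0 ?di0 ?dj0 // => /andP[/eqP/(diz x cx)[_ hi] /eqP/(djz x cx)[_ hj]].
    by rewrite mev_affine // aff_subE -hi -hj subrr.
  exists (mcn_affine R (pd j).1 + (pd j).2 *+ k); split=> // x [zx xw];
    have cx := zc x zx; rewrite mevD // mevMn // mev_affine //.
    have := hk x cx; rewrite mev_affine // aff_subE mevD //.
    have di := dic x zx xw; have [_ ->] := diz x cx di.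
    by rewrite di add0r lerBlDl mulr_natl.
  have dj := djc x zx xw; have [_ ->] := djz x cx dj.
  by rewrite dj mul0rn addr0.
by exists g => x zx; apply: (hg (order_code u x)).
Qed.

End Extension.

(** * l-ideals and the quotient projection *)

Section LIdeals.
Variables (G : ulgroupType) (I : lideal G).
Implicit Types f g : G.
Local Open Scope quotient_scope.

Lemma lideal0 : lideal_set I 0.
Proof. by have [/asboolP] := lideal_zmod_closed I. Qed.

Lemma lidealB f g : lideal_set I f -> lideal_set I g -> lideal_set I (f - g).
Proof.
move=> If Ig; have [_ h] := lideal_zmod_closed I.
by apply/asboolP; apply: h; exact/asboolP.
Qed.

Lemma lidealD f g : lideal_set I f -> lideal_set I g -> lideal_set I (f + g).
Proof. move=> If Ig; rewrite -[g]opprK -[- g]sub0r.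
by do 2!apply: lidealB => //; exact: lideal0. Qed.

Lemma lquot_pi_eq f g : \pi_(lquot I) f = \pi_(lquot I) g <-> lideal_set I (f - g).
Proof.
have E : (\pi_(lquot I) f == \pi_(lquot I) g) = lideal_pred I (f - g).
  by rewrite -[LHS](Quotient.idealrBE (lideal_zmod I)).
by split=> [/eqP|/asboolP h]; [rewrite E => /asboolP|apply/eqP; rewrite E].
Qed.

Lemma lquot_pi_hom : ul_hom (fun f => \pi_(lquot I) f).
Proof.
split=> [f g|f g|f g|//]; first exact: lquot_piD.
  exact: lquot_pi_join.
exact: lquot_pi_meet.
Qed.

End LIdeals.

(** * l-ideals of McNaughton functions and their zerosets *)

Section Ideals.
Variables (R : realType) (n : nat) (I : lideal (mcnaughton R n)).
Implicit Types (f g : mcnaughton R n) (x : 'rV[R]_n).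

Lemma lideal_abs f : lideal_set I f -> lideal_set I (mcn_abs f).
Proof.
have [H [phi [hphi ->]]] := lideal_proof I; rewrite /preimage /= => f0.
have [_ pU _ _] := hphi.
have phi0 := ul_hom0 hphi.
rewrite /mcn_abs -[- f]sub0r pU (ul_homB hphi) f0 phi0 subrr.
(* Idempotence of the join, from the two absorption laws. *)
by rewrite -[X in ljoin _ X](ljoinKI _ (0 : H)) lmeetKU.
Qed.

(** Some multiple of [|f|] dominates [g] and some multiple dominates [- g]. A homomorphism with
    kernel [I] kills [|f|], so it sends both [g] and [- g] below 0. *)
Lemma lideal_zeroset_sub f g :
  lideal_set I f -> (forall x, cube R n x -> mev f x = 0 -> mev g x = 0) ->
  lideal_set I g.
Proof.
move=> If fg.
have dom g' : (forall x, cube R n x -> mev f x = 0 -> mev g' x = 0) ->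
    exists k, lmeet g' (mcn_abs f *+ k) = g'.
  move=> fg'; have [x cx|x cx|k hk] := @mcn_dominated R n (mcn_abs f) g'.
  - by rewrite mev_abs.
  - by rewrite mev_abs // => /eqP; rewrite normr_eq0 => /eqP/(fg' x cx) ->.
  exists k; apply: mev_inj => x cx; rewrite mev_meet // mevMn // -mulr_natl.
  by apply/min_idPl; exact: hk.
have [k1 hk1] := dom g fg.
have [|k2 hk2] := dom (- g); first by move=> x cx /(fg x cx) gx; rewrite mevN // gx oppr0.
have := lideal_abs If.
have [H [phi [hphi ->]]] := lideal_proof I; rewrite /preimage /= => f0.
have phi0 := ul_hom0 hphi.
have [pD pU pI _] := hphi.
have fk k : phi (mcn_abs f *+ k) = 0.
  by elim: k => [|k IH]; rewrite ?mulr0n // mulrS pD f0 IH addr0.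
have gneg := congr1 phi hk1; have gpos := congr1 phi hk2.
rewrite !pI !fk -[- g]sub0r (ul_homB hphi) phi0 sub0r in gneg gpos.
have join0 (y : H) : lmeet y 0 = y -> ljoin 0 y = 0.
  by move=> <-; rewrite lmeetC lmeetKU.
(* With [phi g] and [- phi g] both below 0, this instance of translation invariance collapses to
   [- phi g = 0]. *)
have := addr_ljoinr (- phi g) 0 (phi g).
rewrite (join0 _ gneg) addr0 addNr ljoinC (join0 _ gpos) => /eqP.
by rewrite oppr_eq0 => /eqP.
Qed.

(** A sum of absolute values vanishes exactly at the common zeros, and [I] is closed under both
    operations. *)
Lemma lideal_common_zeros (T : eqType) (r : seq T) (F : T -> mcnaughton R n) :
  (forall i, i \in r -> lideal_set I (F i)) ->
  exists2 f, lideal_set I f & forall x, cube R n x ->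
    mev f x = 0 <-> forall i, i \in r -> mev (F i) x = 0.
Proof.
elim: r => [|i r IH] IF.
  by exists 0 => [|x cx]; [exact: lideal0|rewrite mev0].
have [j jr|f If hf] := IH; first by apply: IF; rewrite inE jr orbT.
exists (mcn_abs (F i) + mcn_abs f) => [|x cx].
  by apply: lidealD; apply: lideal_abs => //; apply: IF; exact: mem_head.
rewrite mevD // !mev_abs //; split=> [/eqP|h].
  rewrite paddr_eq0 // !normr_eq0 => /andP[/eqP Fi /eqP/(hf x cx) h] j.
  by rewrite inE => /orP[/eqP->|/h].
rewrite h ?mem_head // normr0 add0r; apply/eqP; rewrite normr_eq0; apply/eqP.
by apply/(hf x cx) => j jr; apply: h; rewrite inE jr orbT.
Qed.

End Ideals.

(** * Homomorphisms and isomorphisms between quotients *)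

Section QuotientIsomorphism.
Variables (G H : ulgroupType) (I : lideal G) (J : lideal H).
Local Open Scope quotient_scope.

Lemma lquot_lift (phi : G -> H) :
  ul_hom phi -> (forall f, lideal_set I f -> lideal_set J (phi f)) ->
  exists2 sigma : lquot I -> lquot J, ul_hom sigma &
    forall f, sigma (\pi_(lquot I) f) = \pi_(lquot J) (phi f).
Proof.
move=> hphi phiI; pose sigma (z : lquot I) := \pi_(lquot J) (phi (repr z)).
have sigmaE f : sigma (\pi_(lquot I) f) = \pi_(lquot J) (phi f).
  apply/lquot_pi_eq; rewrite -(ul_homB hphi); apply: phiI; apply/lquot_pi_eq.
  exact: reprK.
exists sigma => //.
have [pD pU pI p1] := hphi.
have [iD iU iI i1] := lquot_pi_hom I; have [jD jU jI j1] := lquot_pi_hom J.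
split=> [y z|y z|y z|].
- by rewrite -[y]reprK -[z]reprK -iD !sigmaE pD jD.
- by rewrite -[y]reprK -[z]reprK -iU !sigmaE pU jU.
- by rewrite -[y]reprK -[z]reprK -iI !sigmaE pI jI.
- by rewrite -i1 sigmaE p1 j1.
Qed.

Lemma lquot_lift_lideal (sigma : lquot I -> lquot J) (phi : G -> H) f :
  ul_hom phi -> (forall f, sigma (\pi_(lquot I) f) = \pi_(lquot J) (phi f)) ->
  lideal_set I f -> lideal_set J (phi f).
Proof.
move=> hphi sE If; rewrite -[phi f]subr0 -(ul_hom0 hphi).
by apply/lquot_pi_eq; rewrite -!sE; congr sigma; apply/lquot_pi_eq; rewrite subr0.
Qed.

End QuotientIsomorphism.

Lemma lquot_isomorphic (G H : ulgroupType) (I : lideal G) (J : lideal H)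
    (phi : G -> H) (psi : H -> G) :
  ul_hom phi -> ul_hom psi ->
  (forall f, lideal_set I f -> lideal_set J (phi f)) ->
  (forall g, lideal_set J g -> lideal_set I (psi g)) ->
  (forall f, lideal_set I (psi (phi f) - f)) ->
  (forall g, lideal_set J (phi (psi g) - g)) ->
  ul_isomorphic (lquot I) (lquot J).
Proof.
move=> hphi hpsi phiI psiJ psiphi phipsi.
have [sigma hsigma sE] := lquot_lift hphi phiI.
have [tau _ tE] := lquot_lift hpsi psiJ.
exists sigma => //; exists tau => z; rewrite -[z]reprK.
  by rewrite sE tE; apply/lquot_pi_eq.
by rewrite tE sE; apply/lquot_pi_eq.
Qed.


(** * Z-homeomorphisms and isomorphisms of the quotients *)

Section ZHomeomorphisms.
Variable R : realType.
Local Open Scope quotient_scope.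

(** Each coordinate of [eta] extends by [mcn_extension]; clipping changes nothing on the zeroset,
    because [eta] maps it into the cube. *)
Lemma zmap_mcn_map m n (f0 : mcnaughton R m) (eta : 'rV[R]_m -> 'rV[R]_n) :
  is_zmap (zeroset f0) eta -> (forall x, zeroset f0 x -> cube R n (eta x)) ->
  exists b : 'I_n -> mcnaughton R m,
    forall x, zeroset f0 x -> mcn_map b x = eta x.
Proof.
move=> [/within_continuous_rowP ceta [s hs]] etac.
have /(_ _)/cid-/all_sig[b hb] j : exists g : mcnaughton R m,
    forall x, zeroset f0 x -> mev g x = eta x 0 j.
  apply: (@mcn_extension R m f0 _ [seq (col j p.1, col j p.2) | p <- s]) => //.
  move=> x zx; have [p ps ->] := hs x zx.
  exists (col j p.1, col j p.2); first exact: map_f.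
  rewrite /zaffine !map_col !mxE; congr (_ + _).
  by apply: eq_bigr => i _; rewrite !mxE.
exists b => x zx; apply/rowP => j; have /zerosetP[cx _] := zx.
rewrite mxE mev_clip // hb //; have /andP[e0 e1] := etac x zx j.
by rewrite (max_idPl e0) (min_idPl e1).
Qed.

(** The composite vanishes wherever [f] and [f0] both do, and membership in [I] can be read off from
    zeros. *)
Lemma mcn_comp_lideal m n (I : lideal (mcnaughton R m)) (J : lideal (mcnaughton R n))
    (f0 : mcnaughton R m) (eta : 'rV[R]_m -> 'rV[R]_n) (b : 'I_n -> mcnaughton R m) :
  lideal_set I f0 -> (forall x, zeroset f0 x -> mcn_map b x = eta x) ->
  (forall g, lideal_set J g -> exists2 f, lideal_set I f &
     forall x, zeroset f0 x -> mev f x = 0 -> mev g (eta x) = 0) ->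
  forall g, lideal_set J g -> lideal_set I (mcn_comp b g).
Proof.
move=> If0 beta transfer g /transfer[f If fg].
have [|f1 If1 hf1] := @lideal_common_zeros R m I _ [:: f; f0] id.
  by move=> f'; rewrite !inE => /orP[]/eqP->.
apply: (lideal_zeroset_sub If1) => x cx /(hf1 x cx) z.
have zx : zeroset f0 x by apply/zerosetP; rewrite z ?inE ?eqxx ?orbT.
by rewrite mev_comp // beta // fg // z ?mem_head.
Qed.

Lemma mcn_comp_retract m n (I : lideal (mcnaughton R m)) (f0 : mcnaughton R m)
    (b : 'I_n -> mcnaughton R m) (c : 'I_m -> mcnaughton R n) :
  lideal_set I f0 -> (forall x, zeroset f0 x -> mcn_map c (mcn_map b x) = x) ->
  forall f, lideal_set I (mcn_comp b (mcn_comp c f) - f).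
Proof.
move=> If0 bc f; apply: (lideal_zeroset_sub If0) => x cx fx.
rewrite mevB // mev_comp // mev_comp ?bc ?subrr //; last exact: mcn_map_cube.
exact/zerosetP.
Qed.

(** Take [b] to be lifts of the images of the coordinates; the two homomorphisms agree on
    coordinates, hence everywhere. *)
Lemma lquot_hom_comp m n (J : lideal (mcnaughton R n))
    (phi : mcnaughton R m -> lquot J) : ul_hom phi ->
  exists b : 'I_m -> mcnaughton R n, forall f, phi f = \pi_(lquot J) (mcn_comp b f).
Proof.
move=> hphi; pose b i := repr (phi (mcn_coord R i)); exists b.
have [jD jU jI j1] := lquot_pi_hom J; have [cD cU cI c1] := mcn_comp_hom b.
apply: mcn_hom_ext => // [|i].
  split=> [f g|f g|f g|].
  - by rewrite cD jD.
  - by rewrite cU jU.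
  - by rewrite cI jI.
  - by rewrite c1 j1.
(* Lifts may leave [0,1], but clipping commutes with both homomorphisms and fixes the
   coordinates. *)
rewrite mcn_comp_coord (clip_hom _ (lquot_pi_hom J)) reprK.
by rewrite -(clip_hom _ hphi) clip_coord.
Qed.

(** A point is fixed exactly when every coordinate of the composite map minus that coordinate
    vanishes there; these finitely many differences lie in [I]. *)
Lemma fixed_points_zeroset m n (I : lideal (mcnaughton R m))
    (b : 'I_m -> mcnaughton R n) (c : 'I_n -> mcnaughton R m) :
  (forall f, \pi_(lquot I) (mcn_comp c (mcn_comp b f)) = \pi_(lquot I) f) ->
  zerosets I [set x | cube R m x /\ mcn_map b (mcn_map c x) = x].
Proof.
move=> bc.
pose F i := mcn_comp c (mcn_comp b (mcn_coord R i)) - mcn_coord R i.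
have [|f If hf] := @lideal_common_zeros R m I _ (enum 'I_m) F.
  by move=> i _; apply/lquot_pi_eq.
have FE i x : cube R m x -> mev (F i) x = mcn_map b (mcn_map c x) 0 i - x 0 i.
  move=> cx; have cy := mcn_map_cube c cx; have cz := mcn_map_cube b cy.
  by rewrite mevB // mev_comp // mev_comp // !mev_coord.
exists f => //; apply/seteqP; split=> x.
  move=> /zerosetP[cx /(hf x cx) h]; split=> //; apply/rowP => i; apply/eqP.
  by rewrite -subr_eq0 -FE // h // mem_enum.
move=> [cx bcx]; apply/zerosetP; split=> //; apply/(hf x cx) => i _.
by rewrite FE // bcx subrr.
Qed.

Lemma isomorphic_zhomeo m n (I : lideal (mcnaughton R m)) (J : lideal (mcnaughton R n)) :
  ul_isomorphic (lquot I) (lquot J) ->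
  exists (P : set 'rV[R]_m) (Q : set 'rV[R]_n) (eta : 'rV[R]_m -> 'rV[R]_n),
    [/\ zerosets I P, zerosets J Q, is_zhomeo P Q eta
      & set_bij (zerosets_cap I P) (zerosets_cap J Q)
          (fun X : set 'rV[R]_m => eta @` X)].
Proof.
move=> [sigma hsigma [tau st ts]].
have [sD sU sI s1] := hsigma; have [iD iU iI i1] := lquot_pi_hom I.
have [jD jU jI j1] := lquot_pi_hom J.
have [|b bE] := @lquot_hom_comp m n J (fun f => sigma (\pi_(lquot I) f)).
  split=> [f g|f g|f g|].
  - by rewrite iD sD.
  - by rewrite iU sU.
  - by rewrite iI sI.
  - by rewrite i1 s1.
have [|c cE] := @lquot_hom_comp n m I (fun g => tau (\pi_(lquot J) g)).
  (* [tau] is given only as an inverse function; injectivity of [sigma] makes it a homomorphism. *)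
  split=> [f g|f g|f g|]; apply: (can_inj st); rewrite ?ts.
  - by rewrite jD sD !ts.
  - by rewrite jU sU !ts.
  - by rewrite jI sI !ts.
  - by rewrite j1 s1.
pose P := [set x | cube R m x /\ mcn_map b (mcn_map c x) = x].
pose Q := [set y | cube R n y /\ mcn_map c (mcn_map b y) = y].
have PQ x : P x -> Q (mcn_map c x).
  by move=> [cx bcx]; split; [exact: mcn_map_cube|rewrite bcx].
have QP y : Q y -> P (mcn_map b y).
  by move=> [cy cby]; split; [exact: mcn_map_cube|rewrite cby].
have compI g : lideal_set J g -> lideal_set I (mcn_comp c g).
  by apply: (lquot_lift_lideal (sigma := tau)) => //; exact: mcn_comp_hom.
have compJ f : lideal_set I f -> lideal_set J (mcn_comp b f).
  by apply: (lquot_lift_lideal (sigma := sigma)) => //; exact: mcn_comp_hom.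
exists P, Q, (mcn_map c); split.
- by apply: fixed_points_zeroset => f; rewrite -cE -bE st.
- by apply: fixed_points_zeroset => g; rewrite -bE -cE ts.
- split.
  + split=> [x|x y /set_mem[_ bx] /set_mem[_ by_] cxy|y Qy].
    * exact: PQ.
    * by rewrite -bx -by_ cxy.
    * by exists (mcn_map b y); [exact: QP|case: Qy].
  + by apply: mcn_map_zmap => x [].
  + exists (mcn_map b); last by apply: mcn_map_zmap => y [].
    by move=> x /set_mem[].
- split.
  (* The zeroset of [f] in P is carried onto the zeroset of [f] composed with [b] in Q. *)
  + move=> _ [_ [f If <-] <-]; exists (zeroset (mcn_comp b f)).
      by exists (mcn_comp b f) => //; exact: compJ.
    apply/seteqP; split=> [y [/zerosetP[cy fy] Qy]|_ [x [/zerosetP[cx fx] Px] <-]].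
      exists (mcn_map b y); last by case: Qy.
      split; last exact: QP.
      by apply/zerosetP; split; [exact: mcn_map_cube|rewrite -mev_comp].
    have [cy _] := PQ x Px; split; last exact: PQ.
    apply/zerosetP; split=> //; rewrite mev_comp //.
    by case: Px => _ ->.
  + move=> X Y /set_mem[X' _ <-] /set_mem[Y' _ <-] XY.
    (* On subsets of P the image determines the set, since [mcn_map b] undoes [mcn_map c] there. *)
    have sub (U V : set 'rV[R]_m) : mcn_map c @` (U `&` P) = mcn_map c @` (V `&` P) ->
        U `&` P `<=` V `&` P.
      move=> UV x UPx; have : (mcn_map c @` (U `&` P)) (mcn_map c x) by exists x.
      rewrite UV => -[z VPz zx]; suff <- : z = x by [].
      by case: UPx VPz => _ [_ <-] [_ [_ <-]]; rewrite zx.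
    by apply/seteqP; split; apply: sub.
  + move=> _ [_ [g Jg <-] <-]; exists (zeroset (mcn_comp c g) `&` P).
      by exists (zeroset (mcn_comp c g)) => //; exists (mcn_comp c g) => //; exact: compI.
    apply/seteqP; split=> [_ [x [/zerosetP[cx gx] Px] <-]|y [/zerosetP[cy gy] Qy]].
      split; last exact: PQ.
      by apply/zerosetP; split; [exact: mcn_map_cube|rewrite -mev_comp].
    exists (mcn_map b y); last by case: Qy.
    split; last exact: QP.
    apply/zerosetP; split; first exact: mcn_map_cube.
    by rewrite mev_comp; [case: Qy => _ ->|exact: mcn_map_cube].
Qed.

Lemma zhomeo_isomorphic m n (I : lideal (mcnaughton R m)) (J : lideal (mcnaughton R n))
    (P : set 'rV[R]_m) (Q : set 'rV[R]_n) (eta : 'rV[R]_m -> 'rV[R]_n) :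
  zerosets I P -> zerosets J Q -> is_zhomeo P Q eta ->
  set_bij (zerosets_cap I P) (zerosets_cap J Q)
    (fun X : set 'rV[R]_m => eta @` X) ->
  ul_isomorphic (lquot I) (lquot J).
Proof.
move=> [f0 If0 <-] [g0 Jg0 <-] [[etaPQ _ etaQ] zeta [theta etaK ztheta]].
move=> [capIJ _ capJI].
have thetaK x : zeroset f0 x -> theta (eta x) = x.
  by move=> Px; apply: etaK; exact/mem_set.
have etaK' y : zeroset g0 y -> zeroset f0 (theta y) /\ eta (theta y) = y.
  by move=> /etaQ[x Px <-]; rewrite thetaK.
have [|b bE] := zmap_mcn_map zeta.
  by move=> x /etaPQ/zerosetP[].
have [|c cE] := zmap_mcn_map ztheta.
  by move=> y /etaK'[/zerosetP[]].
(* Composition is contravariant: [c], which extends [theta], carries functions on the first cube to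
   the second. *)
apply: (@lquot_isomorphic _ _ I J (mcn_comp c) (mcn_comp b)).
- exact: mcn_comp_hom.
- exact: mcn_comp_hom.
- apply: (mcn_comp_lideal Jg0 cE) => f If.
  have [|_ [g Jg <-] gE] := capIJ (zeroset f `&` zeroset f0).
    by exists (zeroset f) => //; exists f.
  exists g => // y Qy gy; have /zerosetP[cy _] := Qy.
  have : (zeroset g `&` zeroset g0) y by split=> //; exact/zerosetP.
  by rewrite gE => -[x [/zerosetP[_ fx] Px] <-]; rewrite thetaK.
- apply: (mcn_comp_lideal If0 bE) => g Jg.
  (* Here surjectivity of the map on zerosets provides [f]; the previous case only needed that it
     lands in the zerosets of [J]. *)
  have [|_ [_ [f If <-] <-] fE] := capJI (zeroset g `&` zeroset g0).
    by exists (zeroset g) => //; exists g.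
  exists f => // x Px fx; have /zerosetP[cx _] := Px.
  suff : (zeroset g `&` zeroset g0) (eta x) by case=> /zerosetP[].
  by rewrite -fE; exists x => //; split=> //; exact/zerosetP.
- apply: (mcn_comp_retract If0) => x Px.
  by rewrite bE // cE ?thetaK //; exact: etaPQ.
- apply: (mcn_comp_retract Jg0) => y Qy; have [Py ey] := etaK' y Qy.
  by rewrite cE // bE.
Qed.

End ZHomeomorphisms.

Theorem theorem3p1 (R : realType) (m n : nat) (hm : (1 <= m)%N) (hn : (1 <= n)%N)
    (I : lideal (mcnaughton R m)) (J : lideal (mcnaughton R n)) :
  ul_isomorphic (lquot I) (lquot J) <->
  exists (P : set 'rV[R]_m) (Q : set 'rV[R]_n) (eta : 'rV[R]_m -> 'rV[R]_n),
    [/\ zerosets I P, zerosets J Q, is_zhomeo P Q eta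
      & set_bij (zerosets_cap I P) (zerosets_cap J Q)
          (fun X : set 'rV[R]_m => eta @` X)].
Proof.
split; first exact: isomorphic_zhomeo.
by move=> [P [Q [eta [IP JQ PQ bij]]]]; exact: (zhomeo_isomorphic IP JQ PQ bij).
Qed.
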